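(* Let $\Omega$ be a Frobenius superpotential on $(X,L)$ with coefficient homomorphisms $\mathrm{OGW}^{(\ell)}_{\beta,k}$, and assume that the cohomology ring $H^*(X;\mathbb R)$ is generated by $H^2(X;\mathbb R)$. Assume $S_L=\ker(\omega\oplus\mu)$. Assume that there exist $\beta'\in\Pi_{>0}$ with $\omega(\beta')=\hbar$, $\ell'\in\mathbb Z_{\ge1}$ and $0\le i_1,\dots,i_{\ell'}\le\kappa$ for which $$\mathrm{OGW}^{(\ell')}_{\beta',0}(\Gamma_{i_1}\otimes\dots\otimes\Gamma_{i_{\ell'}})\ne0.$$ Assume further that the pair $(\beta',\ell')$ is minimal in the sense that for any $\beta''\in\Pi_{>0}$ with $\omega(\beta'')=\hbar$, any $\ell''\in\mathbb Z_{\ge0}$ with $\ell''<\ell'$, and any $0\le j_1,\dots,j_{\ell''}\le\kappa$, the term $\mathrm{OGW}^{(\ell'')}_{\beta'',0}(\Gamma_{j_1}\otimes\dots\otimes\Gamma_{j_{\ell''}})$ vanishes. If either $\ell'>1$ or $|\Gamma_{i_1}|=2n$, then for any $\beta\in\Pi_{\ge0}$, $k,\ell\in\mathbb Z_{\ge0}$ and $\gamma_1,\dots,\gamma_\ell\in H^*(X,L;\mathbb R)$ the value $\mathrm{OGW}^{(\ell)}_{\beta,k}(\gamma_1\otimes\dots\otimes\gamma_\ell)$ can be computed from the following sets of initial values: $$\{\mathrm{OGW}^{(\ell')}_{\beta',0}(\Gamma_{i_1}\otimes\dots\otimes\Gamma_{i_{\ell'}})\},$$ $$\{\mathrm{OGW}^{(0)}_{\beta,k}\mid\beta\in\Pi_{\ge0},\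 k\in\{0,1\},\ n-3+\mu(\beta)+k=kn\},$$ $$\{\mathrm{OGW}^{(1)}_{\beta,0}(\Gamma_i)\mid\beta\in\Pi_{\ge0},\ 0\le i\le\kappa,\ n-3+\mu(\beta)+2=|\Gamma_i|\},$$ $$\{\mathrm{GW}_\beta(\gamma_1\otimes\gamma_2\otimes\gamma_3)\mid \beta\in H_2(X;\mathbb Z),\ \gamma_1,\gamma_2,\gamma_3\in H^*(X;\mathbb R),\ |\gamma_3|=2,\ 2n+2c_1(\beta)=|\gamma_1|+|\gamma_2|+|\gamma_3|\}.$$
   Context: **Setting.** $(X,\omega)$ is a closed symplectic manifold, $\dim_{\mathbb R}X=2n$, $n\ge1$; $L\subset X$ is a closed oriented Lagrangian submanifold with a relative spin structure, which determines $w_s\in H^2(X;\mathbb Z/2)$ with $w_s|_L=w_2(TL)$; $J$ is an $\omega$-tame almost complex structure. $\mu:H_2(X,L;\mathbb Z)\to\mathbb Z$ is the Maslov index and $c_1:H_2(X;\mathbb Z)\to\mathbb Z$ the first Chern class. $\Pi=H_2(X,L;\mathbb Z)/S_L$ for a subgroup $S_L\subseteq\ker(\omega\oplus\mu)$; $\beta_0\in\Pi$ is zero; $\Pi_{\ge0}=\{\beta\in\Pi:\omega(\beta)\ge0\}$, $\Pi_{>0}=\{\beta\in\Pi:\omega(\beta)>0\}$. $\varpi:H_2(X;\mathbb Z)\to H_2(X,L;\mathbb Z)\to\Pi$ is the natural map. $\hbar>0$ is a fixed constant such that any class of positive energy represented by a $J$-holomorphic disk $(D,\partial D)\to(X,L)$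 or a $J$-holomorphic sphere has $\omega$-energy at least $\hbar$. **Cohomology and bases.** $H^*(X,L;\mathbb R)$ is the cohomology of the complex of differential forms $\eta$ on $X$ with $\int_L\eta=0$. Let $\mathfrak i:H^*(X;\mathbb R)\to\mathbb R$ be integration over $L$ and $y:\mathbb R\to H^*(X,L;\mathbb R)$ the connecting map of the long exact sequence. $\{\Delta_0,\dots,\Delta_K\}$ is a homogeneous basis of $H^*(X;\mathbb R)$. A basis $\{\Gamma_0,\dots,\Gamma_N\}$ of $H^*(X,L;\mathbb R)$ is chosen as follows. If $[L]=0$ in $H_n(X;\mathbb R)$: $N=K+1$, $\Gamma_i=\Delta_i$ for $i\le K$ (via a splitting $H^*(X,L;\mathbb R)\cong H^*(X;\mathbb R)\oplus\mathbb R\,y(1)$) and $\Gamma_{K+1}=\Gamma_\diamond=y(1)$. If $[L]\ne0$: $N=K-1$, $H^*(X,L;\mathbb R)=\ker\mathfrak i\subset H^*(X;\mathbb R)$, $\Gamma_i=\Delta_i$ for $i\le K-1$, and $\Delta_K=\mathrm{PD}([L])$. Set $\kappa=\min\{K,N\}$. $P_{\mathbb R}:H^*(X,L;\mathbb R)\to\mathrm{Coker}(\mathfrak i)$ is $0$ if $[L]\ne0$; if $[L]=0$ then $P_{\mathbb R}(\Gamma_\diamond)=1$ and $P_{\mathbb R}(\Gamma_j)=0$ for $j\le K$ (so $P_{\mathbb R}$ vanishes on $H^*(X;\mathbb R)$). $g_{ij}=\int_X\Delta_i\wedge\Delta_j$, and $(g^{ij})$ is the inverse matrix of $(g_{ij})_{0\le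 i,j\le K}$. $|\cdot|$ is cohomological degree. **Closed invariants.** $\mathrm{GW}_\beta:H^*(X;\mathbb R)^{\otimes\ell}\to\mathbb R$ are the genus $0$ Gromov-Witten invariants, satisfying the usual degree, fundamental class, zero, divisor and WDVV axioms. The closed potential is $$\Phi=\sum_{\beta\in H_2(X;\mathbb Z),\,r_i\ge0}(-1)^{w_s(\beta)}T^{\varpi(\beta)}\prod_{i=0}^K\frac{t_{K-i}^{r_{K-i}}}{r_{K-i}!}\,\mathrm{GW}_\beta\Big(\bigotimes_{i=0}^K\Delta_{K-i}^{\otimes r_{K-i}}\Big).$$ **Frobenius superpotential.** Let $\Lambda=\{\sum_i a_iT^{\beta_i}: a_i\in\mathbb R,\beta_i\in\Pi,\omega(\beta_i)\ge0,\omega(\beta_i)\to\infty\}$ and $R=\Lambda[[s,t_0,\dots,t_N]]$. Given linear maps $\mathrm{OGW}^{(\ell)}_{\beta,k}:H^*(X,L;\mathbb R)^{\otimes\ell}\to\mathbb R$ ($\beta\in\Pi_{\ge0}$, $k,\ell\ge0$), let $$\Omega=\sum_{\beta,k,\ell}\ \sum_{r_0+\dots+r_N=\ell}T^\beta\frac{s^k}{k!}\prod_{i=0}^N\frac{t_{N-i}^{r_{N-i}}}{r_{N-i}!}\,\mathrm{OGW}^{(\ell)}_{\beta,k}\Big(\bigotimes_{i=0}^N\Gamma_{N-i}^{\otimes r_{N-i}}\Big)\in R.$$ $\Omega$ is a *Frobenius superpotential* if ($\partial_j=\partial_{t_j}$; $\beta\in\Pi_{\ge0}$, $k,\ell\ge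 0$, $\gamma_j\in\{\Gamma_0,\dots,\Gamma_N\}$): (i) Open WDVV: for all $a,b,c\in\{0,\dots,N\}\cup\{s\}$, $$\sum_{0\le\mu,\nu\le\kappa}\partial_a\partial_\mu\Omega\,g^{\mu\nu}\partial_b\partial_c\partial_\nu\Phi-\partial_a\partial_s\Omega\,\partial_b\partial_c\Omega=\sum_{0\le\mu,\nu\le\kappa}\partial_a\partial_b\partial_\mu\Phi\,g^{\mu\nu}\partial_c\partial_\nu\Omega-\partial_a\partial_b\Omega\,\partial_s\partial_c\Omega,$$ $$-\partial_a\partial_s\Omega\,\partial_b\partial_s\Omega=\sum_{0\le\mu,\nu\le\kappa}\partial_a\partial_b\partial_\mu\Phi\,g^{\mu\nu}\partial_s\partial_\nu\Omega-\partial_a\partial_b\Omega\,\partial_s^2\Omega.$$ (ii) Energy gap: $\mathrm{OGW}^{(\ell)}_{\beta,k}=0$ if $\omega(\beta)<\hbar$ and $\beta\ne\beta_0$. (iii) Symmetry: $\mathrm{OGW}^{(\ell)}_{\beta,k}(\gamma_1\otimes\dots\otimes\gamma_\ell)=(-1)^{s_\sigma(\gamma)}\mathrm{OGW}^{(\ell)}_{\beta,k}(\gamma_{\sigma(1)}\otimes\dots\otimes\gamma_{\sigma(\ell)})$ for $\sigma\in S_\ell$, with $s_\sigma(\gamma)=\sum_{i>j,\sigma(i)<\sigma(j)}|\gamma_{\sigma(i)}||\gamma_{\sigma(j)}|$. (iv) Degree: $\mathrm{OGW}^{(\ell)}_{\beta,k}(\gamma_1\otimes\dots\otimes\gamma_\ell)=0$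 unless $n-3+\mu(\beta)+2\ell+k=kn+\sum_i|\gamma_i|$. (v) Fundamental class: for $\ell\ge1$, $\mathrm{OGW}^{(\ell)}_{\beta,k}(1\otimes\gamma_1\otimes\dots\otimes\gamma_{\ell-1})$ is $-1$ if $(\ell,\beta,k)=(1,\beta_0,1)$, $P_{\mathbb R}(\gamma_1)$ if $(\ell,\beta,k)=(2,\beta_0,0)$, and $0$ otherwise. (vi) Zero: $\mathrm{OGW}^{(\ell)}_{\beta_0,k}(\gamma_1\otimes\dots\otimes\gamma_\ell)$ is $-1$ if $(\ell,k)=(1,1)$ and $\gamma_1=1$, $P_{\mathbb R}(\gamma_1\wedge\gamma_2)$ if $(\ell,k)=(2,0)$, and $0$ otherwise. (vii) Divisor: if $\ell\ge1$ and $|\gamma_\ell|=2$, then $\mathrm{OGW}^{(\ell)}_{\beta,k}(\gamma_1\otimes\dots\otimes\gamma_\ell)=\int_\beta\gamma_\ell\cdot\mathrm{OGW}^{(\ell-1)}_{\beta,k}(\gamma_1\otimes\dots\otimes\gamma_{\ell-1})$. (viii) Wall-crossing: if $[L]=0$, then $\mathrm{OGW}^{(\ell+1)}_{\beta,k}(\Gamma_\diamond\otimes\gamma_1\otimes\dots\otimes\gamma_\ell)=-\mathrm{OGW}^{(\ell)}_{\beta,k+1}(\gamma_1\otimes\dots\otimes\gamma_\ell)$. **Computability.** A value ''can be computed from'' (is ''computable via'') a collection of values if the axioms of $\Omega$ and of the closed invariants yield it by a procedure with finitely many steps that depends only on the topological data (cohomology rings, chosen bases, pairings, $\omega,\mu,c_1,w_s$,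 $\hbar$), each step expressing a value through the given or previously obtained ones by sums with finitely many nonzero terms, products, and division by values assumed nonzero. *)

(* Defs.v *)
From HB Require Import structures.
From mathcomp Require Import all_boot all_order all_algebra all_fingroup all_field.
From mathcomp Require Import boolp classical_sets cardinality fsbigop reals.
Set Implicit Arguments.
Unset Strict Implicit.
Unset Printing Implicit Defensive.
Import Order.TTheory GRing.Theory Num.Theory.
Local Open Scope ring_scope.

Definition grading (F : fieldType) (V : vectType F) (m : nat)
    (dg : nat -> {vspace V}) : Prop :=
  [/\ (\sum_(d < m.+1) dg d)%VS = fullv,
      directv (\sum_(d < m.+1) dg d) &
      forall d, (m < d)%N -> dg d = 0%VS].

(* The topological data of a closed symplectic manifold (X, omega) of real     *)
(* dimension 2n with a closed oriented relatively spin Lagrangian L, together  *)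
(* with the chosen bases and the constant hbar.                                *)
Record topData (R : realType) := TopData {
  dimL : nat;
  dimL_gt0 : (0 < dimL)%N;

  (* H^*(X;R) *)
  HX : falgType R;
  degX : nat -> {vspace HX};
  degX_grading : grading dimL.*2 degX;
  degX_one : 1 \in degX 0;
  degX_mul : forall p q (x y : HX),
    x \in degX p -> y \in degX q -> x * y \in degX (p + q);
  degX_comm : forall p q (x y : HX),
    x \in degX p -> y \in degX q -> y * x = (-1) ^+ (p * q) *: (x * y);
  intX : {linear HX -> R^o};
  intX_deg : forall d (x : HX), d != dimL.*2 -> x \in degX d -> intX x = 0;
  poincare_duality : forall x : HX, (forall y, intX (x * y) = 0) -> x = 0;
  (* integration over L; by Poincare duality [L] = 0 iff this map is 0 *)
  intL : {linear HX -> R^o};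
  intL_deg : forall d (x : HX), d != dimL -> x \in degX d -> intL x = 0;
  (* restriction to a point of L *)
  evpt : {lrmorphism HX -> R^o};

  (* H^*(X,L;R), the cohomology of the forms with vanishing integral over L:   *)
  (* ... -> H^*(X) --intL--> R --ybd--> H^*(X,L) --rel--> H^*(X) --intL--> R   *)
  HXL : vectType R;
  degXL : nat -> {vspace HXL};
  degXL_grading : grading dimL.*2 degXL;
  rel : {linear HXL -> HX};
  rel_deg : forall d (x : HXL), x \in degXL d -> rel x \in degX d;
  ybd : {linear R^o -> HXL};
  ybd_deg : ybd 1 \in degXL dimL.+1;
  exact_X : forall z : HX, intL z = 0 <-> exists x, rel x = z;
  exact_XL : forall x : HXL, rel x = 0 <-> exists c, ybd c = x;
  exact_R : forall c : R, ybd c = 0 <-> exists z, intL z = c;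
  (* the class of the constant function 1, whose degree is not n *)
  oneXL : HXL;
  oneXL_deg : oneXL \in degXL 0;
  rel_one : rel oneXL = 1;

  (* H_2(X;Z), H_2(X,L;Z) and Pi = H_2(X,L;Z)/S_L; that S_L is contained in    *)
  (* ker(omega + mu) means that omega and mu are defined on Pi                 *)
  H2X : zmodType;
  H2XL : zmodType;
  Pi : zmodType;
  jH2 : {additive H2X -> H2XL};
  qPi : {additive H2XL -> Pi};
  qPi_surj : forall b, exists x, qPi x = b;
  omega : {additive Pi -> R};
  mu : {additive Pi -> int};
  mu_even : forall b, (2 %| mu b)%Z;    (* L is oriented *)
  chern : {additive H2X -> int};
  mu_chern : forall x, mu (qPi (jH2 x)) = 2 * chern x;
  ws : {additive H2X -> 'Z_2};

  (* integration of degree 2 classes over degree 2 cycles *)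
  pairX : H2X -> {linear HX -> R^o};
  pairX_add : forall x y c, pairX (x + y) c = pairX x c + pairX y c;
  pairXL : H2XL -> {linear HXL -> R^o};
  pairXL_add : forall x y c, pairXL (x + y) c = pairXL x c + pairXL y c;
  pair_compat : forall x c, pairXL (jH2 x) c = pairX x (rel c);

  (* the class of the symplectic form in H^2(X,L;R) *)
  symp : HXL;
  symp_deg : symp \in degXL 2;
  symp_pair : forall x, pairXL x symp = omega (qPi x);
  symp_volume : 0 < intX (rel symp ^+ dimL) :> R;

  hbar : R;
  hbar_gt0 : 0 < hbar;

  (* homogeneous bases Delta_0..Delta_K and Gamma_0..Gamma_N *)
  K : nat;
  Delta : (K.+1).-tuple HX;
  Delta_basis : basis_of fullv Delta;
  degD : 'I_K.+1 -> nat;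
  Delta_deg : forall i, tnth Delta i \in degX (degD i);
  N : nat;
  Gamma : (N.+1).-tuple HXL;
  Gamma_basis : basis_of fullv Gamma;
  degG : 'I_N.+1 -> nat;
  Gamma_deg : forall i, tnth Gamma i \in degXL (degG i);
  Gamma_rel : forall (i : 'I_N.+1) (j : 'I_K.+1),
    i = j :> nat -> rel (tnth Gamma i) = tnth Delta j;
  Gamma_null : (forall z, intL z = 0) ->
    N = K.+1 /\ tnth Gamma ord_max = ybd 1;
  (* the last Delta is PD([L]) *)
  Gamma_nonnull : ~ (forall z, intL z = 0) ->
    K = N.+1 /\ forall z, intL z = intX (z * tnth Delta ord_max)
}.

Section Potentials.
Variables (R : realType) (D : topData R).

Notation Hx := (HX D).
Notation Hxl := (HXL D).

Definition L_null : bool := `[< forall z : Hx, intL D z = 0 >].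

Definition S_L (x : H2XL D) : Prop := qPi D x = 0.

Definition ker_omega_mu (x : H2XL D) : Prop :=
  omega D (qPi D x) = 0 /\ mu D (qPi D x) = 0.

Definition varpi (x : H2X D) : Pi D := qPi D (jH2 D x).

Definition kappa : nat := minn (K D) (N D).

Definition Del (i : 'I_(K D).+1) : Hx := tnth (Delta D) i.
Definition Gam (i : 'I_(N D).+1) : Hxl := tnth (Gamma D) i.

Definition ginv : 'M[R]_((K D).+1) :=
  invmx (\matrix_(i, j) (intX D (Del i * Del j) : R)).

(* Coker(intL) is R if [L] = 0 and 0 otherwise. *)
Definition P_R (x : Hxl) : R :=
  if L_null then coord (Gamma D) ord_max x else 0.

(* The splitting Delta_j |-> Gamma_j (only used when [L] = 0). *)
Definition split_lift (z : Hx) : Hxl :=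
  \sum_(j < (K D).+1) coord (Delta D) j z *: Gam (inord j).

(* The product of H^*(X) + R y(1) when [L] = 0: a class of positive degree     *)
(* kills y(1), and y(1) squares to 0.  When [L] <> 0 it only occurs under      *)
(* P_R = 0.                                                                    *)
Definition wedge (x y : Hxl) : Hxl :=
  split_lift (rel D x * rel D y)
  + ((evpt D (rel D x) : R) * P_R y + P_R x * evpt D (rel D y)) *: ybd D 1.

Definition multilinear (V : lmodType R) (f : seq V -> R) : Prop :=
  forall (s1 s2 : seq V) (a : R) (x y : V),
    f (s1 ++ (a *: x + y) :: s2) = a * f (s1 ++ x :: s2) + f (s1 ++ y :: s2).

Definition graded_symmetric (V : Type) (m : nat) (B : 'I_m -> V)
    (dg : 'I_m -> nat) (f : seq V -> R) : Prop :=
  forall (l : nat) (I : l.-tuple 'I_m) (s : 'S_l),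
    f [seq B i | i <- I] =
    (-1) ^+ (\sum_(i < l) \sum_(j < l | (j < i)%N && (s i < s j)%N)
               dg (tnth I (s i)) * dg (tnth I (s j)))%N
    * f [seq B (tnth I (s i)) | i <- enum 'I_l].

(* B_(m-1)^(r_(m-1)) ... B_0^(r_0) as a list of insertions *)
Definition insertions (V : Type) (m : nat) (B : 'I_m -> V) (r : 'I_m -> nat) :
    seq V :=
  flatten [seq nseq (r i) (B i) | i <- rev (enum 'I_m)].

(* A linear map on the l-th tensor power is a multilinear function of lists    *)
(* of length l; the list length plays the role of l.                           *)
Record invariants := Invariants {
  GW : H2X D -> seq Hx -> R;
  OGW : Pi D -> nat -> seq Hxl -> R
}.

(* Formal series in T^b (b in Pi), s and t_0..t_N: the variables are indexed   *)
(* by option 'I_N.+1, with None for s.  The variables commute: once H^*(X) is  *)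
(* generated in degree 2 and some nonzero OGW has only insertions              *)
(* Gamma_i, i <= kappa, and no boundary point, n is odd and the degrees        *)
(* 2 - |Gamma_j| and 1 - n of the variables are all even.                      *)
Definition var := option 'I_(N D).+1.
Definition expo := {ffun var -> nat}.
Definition series := (Pi D * expo)%type -> R.

(* Membership in Lambda[[s,t_0..t_N]] *)
Definition novikov (f : series) : Prop :=
  (forall b r, f (b, r) != 0 -> 0 <= omega D b) /\
  (forall r (E : R), finite_set [set b | f (b, r) != 0 /\ omega D b <= E]).

Definition smul (f g : series) : series := fun m =>
  \sum_(p \in [set p : (Pi D * expo) * (Pi D * expo) | p.1 + p.2 = m])
    f p.1 * g p.2.

Definition dvar (v : var) (f : series) : series := fun m =>
  (m.2 v).+1%:R * f (m.1, m.2 + [ffun w => (w == v) : nat]).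

Definition tvar (i : nat) : var := Some (inord i).
Definition svar : var := None.

(* Phi as a series in T^b and t_0..t_K *)
Definition closed_potential (M : invariants) (b : Pi D)
    (r : {ffun 'I_(K D).+1 -> nat}) : R :=
  (\prod_i (r i)`!%:R)^-1 *
  \sum_(x \in [set x : H2X D | varpi x = b])
     (-1) ^+ (ws D x : nat) * GW M x (insertions Del r).

(* Phi inside Lambda[[s,t_0..t_N]]: it involves neither s nor t_(K+1), and     *)
(* t_K = 0 when N = K - 1.                                                     *)
Definition Phi (M : invariants) : series := fun m =>
  if (m.2 svar == 0%N) &&
     [forall i : 'I_(N D).+1, (K D < i)%N ==> (m.2 (Some i) == 0%N)]
  then closed_potential M m.1
         [ffun j : 'I_(K D).+1 => if (j <= N D)%N then m.2 (tvar j) else 0%N]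
  else 0.

Definition Omega (M : invariants) : series := fun m =>
  if 0 <= omega D m.1 then
    (\prod_v (m.2 v)`!%:R)^-1 *
    OGW M m.1 (m.2 svar) (insertions Gam (fun i => m.2 (Some i)))
  else 0.

Definition contract (F G : nat -> series) : series := fun m =>
  \sum_(i < kappa.+1) \sum_(j < kappa.+1)
     ginv (inord i) (inord j) * smul (F i) (G j) m.

Definition open_WDVV (M : invariants) : Prop :=
  let O := Omega M in let F := Phi M in let d := dvar in
  (forall (a b c : var) m,
     contract (fun i => d a (d (tvar i) O))
              (fun j => d b (d c (d (tvar j) F))) m
     - smul (d a (d svar O)) (d b (d c O)) m
   = contract (fun i => d a (d b (d (tvar i) F)))
              (fun j => d c (d (tvar j) O)) m
     - smul (d a (d b O)) (d svar (d c O)) m) /\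
  (forall (a b : var) m,
     - smul (d a (d svar O)) (d b (d svar O)) m
   = contract (fun i => d a (d b (d (tvar i) F)))
              (fun j => d svar (d (tvar j) O)) m
     - smul (d a (d b O)) (d svar (d svar O)) m).

Definition open_deg (b : Pi D) (k : nat) (l : nat) (e : nat) : Prop :=
  (dimL D)%:Z - 3 + mu D b + 2 * l%:Z + k%:Z = k%:Z * (dimL D)%:Z + e%:Z.

(* gap_bound is the energy gap for closed invariants: a nonconstant            *)
(* J-holomorphic sphere has energy at least hbar.  gw_finite is Gromov         *)
(* compactness, which makes Phi well defined.  gw_WDVV is stated for           *)
(* insertions of even degree, where it carries no sign.                        *)
Record closed_axioms (M : invariants) : Prop := ClosedAxioms {
  gw_linear : forall x, multilinear (GW M x);
  gw_sym : forall x, graded_symmetric Del (@degD R D) (GW M x);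
  gw_finite : forall s (E : R),
    finite_set [set x | GW M x s != 0 /\ omega D (varpi x) <= E];
  gw_gap : forall (x : H2X D) s, x != 0 -> omega D (varpi x) < hbar D -> GW M x s = 0;
  gw_degree : forall x (I : seq 'I_(K D).+1),
    GW M x (map Del I) != 0 ->
    (dimL D).*2%:Z - 6 + 2 * chern D x + 2 * (size I)%:Z
      = (\sum_(i <- I) degD i)%N%:Z;
  gw_fundamental : forall (x : H2X D) (I : seq 'I_(K D).+1),
    GW M x (1 :: map Del I) =
    if I is [:: i; j] then
      if x == 0 then intX D (Del i * Del j) else 0
    else 0;
  gw_zero : forall I : seq 'I_(K D).+1,
    GW M 0 (map Del I) =
    if I is [:: i; j; l] then intX D (Del i * Del j * Del l) else 0;
  gw_divisor : forall (x : H2X D) (I : seq 'I_(K D).+1) j,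
    degD j = 2%N -> x != 0 \/ size I <> 2%N ->
    GW M x (rcons (map Del I) (Del j)) = pairX x (Del j) * GW M x (map Del I);
  gw_WDVV : forall x (a b c e : 'I_(K D).+1) (I : seq 'I_(K D).+1),
    all (fun i => ~~ odd (degD i)) [:: a, b, c, e & I] ->
    let split2 a b c e :=
      \sum_(p \in [set p : H2X D * H2X D | p.1 + p.2 = x])
        \sum_(m : (size I).-tuple bool) \sum_i \sum_j
          GW M p.1 ([:: Del a; Del b; Del i] ++ map Del (mask m I))
          * ginv i j
          * GW M p.2 ([:: Del j; Del c; Del e] ++ map Del (mask (map negb m) I))
    in split2 a b c e = split2 a c b e
}.

Record frobenius_superpotential (M : invariants) : Prop := FrobeniusSuperpotential {
  ogw_linear : forall b k, 0 <= omega D b -> multilinear (OGW M b k);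
  Omega_novikov : novikov (Omega M);
  ogw_WDVV : open_WDVV M;
  ogw_gap : forall b k s, 0 <= omega D b -> omega D b < hbar D -> b != 0 ->
    OGW M b k s = 0;
  ogw_sym : forall b k, 0 <= omega D b ->
    graded_symmetric Gam (@degG R D) (OGW M b k);
  ogw_degree : forall b k (I : seq 'I_(N D).+1), 0 <= omega D b ->
    OGW M b k (map Gam I) != 0 -> open_deg b k (size I) (\sum_(i <- I) degG i);
  ogw_fundamental : forall b k (I : seq 'I_(N D).+1), 0 <= omega D b ->
    OGW M b k (oneXL D :: map Gam I) =
    match I with
    | [::] => if (b == 0) && (k == 1%N) then -1 else 0
    | [:: i] => if (b == 0) && (k == 0%N) then P_R (Gam i) else 0
    | _ => 0
    end;
  ogw_zero : forall k (I : seq 'I_(N D).+1),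
    OGW M 0 k (map Gam I) =
    match I with
    | [:: i] => if (k == 1%N) && (Gam i == oneXL D) then -1 else 0
    | [:: i; j] => if k == 0%N then P_R (wedge (Gam i) (Gam j)) else 0
    | _ => 0
    end;
  (* the integral over b is computed on any representative in H_2(X,L;Z) *)
  ogw_divisor : forall (x : H2XL D) k (I : seq 'I_(N D).+1) j,
    0 <= omega D (qPi D x) -> degG j = 2%N ->
    OGW M (qPi D x) k (rcons (map Gam I) (Gam j)) =
    pairXL x (Gam j) * OGW M (qPi D x) k (map Gam I);
  ogw_wall : forall b k (I : seq 'I_(N D).+1), L_null -> 0 <= omega D b ->
    OGW M b k (Gam ord_max :: map Gam I) = - OGW M b k.+1 (map Gam I)
}.

Inductive value :=
| OpenValue of Pi D & nat & seq Hxl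
| ClosedValue of H2X D & seq Hx.

Definition val_of (M : invariants) (v : value) : R :=
  match v with
  | OpenValue b k s => OGW M b k s
  | ClosedValue x s => GW M x s
  end.

(* Computations from a set A of given values, with division by the values in   *)
(* Z.  The real constants stand for topological data.  A sum may range over an *)
(* infinite index set (such as all splittings b = b1 + b2) provided that only  *)
(* finitely many of its terms are nonzero, see [sound]; once the zero terms    *)
(* are discarded, the tree is finite by Koenig's lemma.                        *)
Inductive formula (A Z : set value) : Type :=
| FConst of R
| FVal (v : value) of A v
| FSum (T : choiceType) of (T -> formula A Z)
| FMul of formula A Z & formula A Z
| FDiv (e : formula A Z) (v : value) of Z v.

Fixpoint eval (A Z : set value) (M : invariants) (e : formula A Z) : R :=
  match e with
  | FConst c => c
  | FVal v _ => val_of M v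
  | FSum _ f => \sum_(i \in [set: _]) eval M (f i)
  | FMul e1 e2 => eval M e1 * eval M e2
  | FDiv e v _ => eval M e / val_of M v
  end.

Fixpoint sound (A Z : set value) (M : invariants) (e : formula A Z) : Prop :=
  match e with
  | FConst _ | FVal _ _ => True
  | FSum _ f => (forall i, sound M (f i)) /\
                finite_set [set i | eval M (f i) != 0]
  | FMul e1 e2 => sound M e1 /\ sound M e2
  | FDiv e v _ => sound M e /\ val_of M v != 0
  end.

(* The formula is chosen before the invariants M: it depends on the            *)
(* topological data D only, and the axioms in P guarantee its outcome.         *)
Definition computable_from (P : invariants -> Prop) (A Z : set value)
    (v : value) : Prop :=
  exists e : formula A Z, forall M, P M -> sound M e /\ eval M e = val_of M v.

Definition nonzero_at (M : invariants) (b : Pi D) (I : seq 'I_(N D).+1) : Prop :=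
  OGW M b 0 (map Gam I) != 0.

Definition minimal_length (M : invariants) (l : nat) : Prop :=
  forall (b : Pi D) (J : seq 'I_(N D).+1),
    0 < omega D b -> omega D b = hbar D -> (size J < l)%N ->
    all (fun j : 'I_(N D).+1 => (j <= kappa)%N) J ->
    OGW M b 0 (map Gam J) = 0.

Definition initial_disk (b : Pi D) (I : seq 'I_(N D).+1) : set value :=
  [set OpenValue b 0 (map Gam I)].

Definition initial_boundary : set value :=
  [set v | exists (b : Pi D) (k : nat), [/\ 0 <= omega D b, (k <= 1)%N, open_deg b k 0 0 &
                          v = OpenValue b k [::]]].

Definition initial_interior : set value :=
  [set v | exists (b : Pi D) (i : 'I_(N D).+1), [/\ 0 <= omega D b, (i <= kappa)%N,
                          open_deg b 0 1 (degG i) &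
                          v = OpenValue b 0 [:: Gam i]]].

Definition initial_closed : set value :=
  [set v | exists (x : H2X D) (p q : nat) (c1 c2 c3 : Hx),
     [/\ c1 \in degX D p, c2 \in degX D q, c3 \in degX D 2,
         (dimL D).*2%:Z + 2 * chern D x = (p + q + 2)%N%:Z &
         v = ClosedValue x [:: c1; c2; c3]]].

Definition initial_values (b : Pi D) (I : seq 'I_(N D).+1) : set value :=
  (initial_disk b I `|` initial_boundary `|` initial_interior
   `|` initial_closed)%classic.

End Potentials.

(* Main.v *)
(* Wall-crossing trades Gamma_diamond for boundary points, and since H^* is     *)
(* generated by H^2 every class of degree at least 4 is a combination of       *)
(* products of a divisor and a class of smaller degree.  WDVV relations with   *)
(* such products then trade insertions for divisors, which the divisor axiom   *)
(* removes, modulo terms in which both factors have energy at least hbar.      *)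
(* Closed invariants are thus reduced to three points (Kontsevich-Manin), and  *)
(* by induction on the energy the open ones are reduced to OGW_{b,k}() and     *)
(* OGW_{b,0}(Gamma_i).  For k at least 2 the value OGW_{b,k}() comes from the  *)
(* WDVV relation containing OGW_{b',0}(delta, pt) OGW_{b,k}() with delta a     *)
(* divisor: at energy hbar, WDVV and minimality force l' = 1, so that          *)
(* OGW_{b',0}(pt) is nonzero.                                                  *)

Require Import Defs.
From HB Require Import structures.
From mathcomp Require Import all_boot all_order all_algebra all_fingroup all_field.
From mathcomp Require Import boolp classical_sets cardinality fsbigop reals.
From mathcomp Require Import functions zify ring lra.
Set Implicit Arguments.
Unset Strict Implicit.
Unset Printing Implicit Defensive.
Import Order.TTheory GRing.Theory Num.Theory.
Local Open Scope ring_scope.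

Arguments Del {R D} i.
Arguments Gam {R D} i.

(** * Functions of the invariants computable from the given values *)

(** The proof climbs the energy in steps of [hbar]. In a WDVV relation a constant sphere contributes
    a cup product, and this is the only kind of term in which an open invariant keeps the whole
    energy. In every other term the open factors lose at least [hbar], so they are known once
    everything below [E] is known and the total energy is below [E + hbar].

    The nonzero disk has only insertions from H^*(X), which is even since it is generated by H^2.
    The degree axiom modulo 2 then makes n odd ([dimL_odd]), hence [L] = 0, all signs are trivial,
    and the only insertion not coming from H^*(X) is Gamma_diamond. [wall_crossing_computable] turns
    it into a boundary point.

    The closed invariants are settled by [gw_step]. For open invariants
    [ogw_computable_insert_interior] treats k = 0, and [ogw_computable_insert_boundary] removes the
    interior insertions when k is positive. There remain the OGW_{g,k}() with k at least 2. By
    [ogw_minimal_long] the given disk has l' = 1, so it is OGW_{b',0}(pt). Take a divisor [j] with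
    nonzero integral over [b'] ([symp_divisor]). As [j] times the point class is 0, WDVV at class
    [g + b'] gives the convolution over [y] of OGW_{b'+y,0}(pt, j) with OGW_{g-y,k}() in terms of
    known values. The term [y = 0] has the given nonzero value as a factor. Because S_L = ker(omega
    + mu), it is the only one of lowest energy ([disk_support]), so the convolution can be inverted
    by a geometric series ([geometric_computable]). *)

Section FiniteSupport.
Local Open Scope classical_set_scope.
Variables (K : idomainType) (T : choiceType).
Implicit Types (A B : set T) (f g : T -> K).

Lemma fsbig_neq0_sub A f (B : set T) : (forall i, B i -> A i) ->
  (forall i, A i -> f i != 0 -> B i) ->
  \sum_(i \in A) f i = \sum_(i \in B) f i.
Proof.
move=> BA fB; apply/esym/fsbig_widen => // i [Ai nBi] /=.
by apply/eqP; apply: contra_notT nBi => /fB; apply.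
Qed.

Lemma fsum_neq0 A f : \sum_(i \in A) f i != 0 -> exists2 i, A i & f i != 0.
Proof.
move=> nz; apply: contrapT => no; case/eqP: nz; apply: fsbig1 => i Ai.
by apply/eqP; apply: contrapT => /negP fi; apply: no; exists i.
Qed.

(** A sum with infinite support is 0 by convention, so additivity rests on the finiteness of both
    supports. *)
Lemma fsbig_splitS A f g :
  finite_set [set i | A i /\ f i != 0] -> finite_set [set i | A i /\ g i != 0] ->
  \sum_(i \in A) (f i + g i) = \sum_(i \in A) f i + \sum_(i \in A) g i.
Proof.
move=> fF gF.
pose U := [set i | A i /\ f i != 0] `|` [set i | A i /\ g i != 0].
have UF : finite_set U by rewrite finite_setU.
have UA i : U i -> A i by case=> -[].
rewrite !(@fsbig_neq0_sub A _ U) //; first exact: fsbig_split.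
- by move=> i Ai nz; right.
- by move=> i Ai nz; left.
move=> i Ai; have [->|nz _] := eqVneq (f i) 0; last by left.
by rewrite add0r => nz; right.
Qed.

Lemma fsbigD1S A f x : A x -> finite_set [set i | A i /\ f i != 0] ->
  \sum_(i \in A) f i = f x + \sum_(i \in A `&` [set i | i != x]) f i.
Proof.
move=> Ax fF; pose B := x |` [set i | A i /\ f i != 0].
have BF : finite_set B by rewrite finite_setU; split=> //; exact: finite_set1.
rewrite (@fsbig_neq0_sub _ _ B); first last.
- by move=> i Ai nz; right.
- by move=> i [->|[]].
rewrite (fsbigD1 x) //; last by left.
congr (_ + _); apply/esym/fsbig_neq0_sub => i.
  by case=> -[->|[Ai nz]] /eqP.
by move=> [Ai /eqP ne] nz; split=> //; right.
Qed.

Lemma fsbigIDS A B f : finite_set [set i | A i /\ f i != 0] ->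
  \sum_(i \in A) f i = \sum_(i \in A `&` B) f i + \sum_(i \in A `&` ~` B) f i.
Proof.
move=> fF; rewrite 2!fsbig_mkcondr -fsbig_splitS.
- apply: eq_fsbigr => i _; rewrite in_setC.
  by case: (i \in B); rewrite ?addr0 ?add0r.
- by apply: sub_finite_set fF => i [Ai]; case: ifP => // _; rewrite eqxx.
- by apply: sub_finite_set fF => i [Ai]; case: ifP => // _; rewrite eqxx.
Qed.

End FiniteSupport.

Section Computable.
Local Open Scope classical_set_scope.
Variables (R : realType) (D : topData R) (P : invariants D -> Prop).
Variables (A Z : set (value D)).
Implicit Types f g : invariants D -> R.

(** The case where [f] is a single value is [computable_from]. General functions of the invariants
    are allowed because the intermediate results are coefficients and sums. *)
Definition computable f : Prop :=
  exists e : formula A Z, forall M, P M -> sound M e /\ eval M e = f M.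

Lemma computable_ext f g :
  (forall M, P M -> f M = g M) -> computable f -> computable g.
Proof.
move=> fg [e he]; exists e => M PM.
by have [? ->] := he M PM; rewrite fg.
Qed.

Lemma computable_const c : computable (fun=> c).
Proof. by exists (FConst _ _ c). Qed.

Lemma computable_val v : A v -> computable (fun M => val_of M v).
Proof. by move=> Av; exists (FVal Z Av). Qed.

Lemma computableM f g :
  computable f -> computable g -> computable (fun M => f M * g M).
Proof.
move=> [e he] [e' he']; exists (FMul e e') => M PM /=.
by have [? ->] := he M PM; have [? ->] := he' M PM.
Qed.

Lemma computable_div f v : Z v -> (forall M, P M -> val_of M v != 0) ->
  computable f -> computable (fun M => f M / val_of M v).
Proof.
move=> Zv nz [e he]; exists (FDiv e Zv) => M PM /=.
by have [? ->] := he M PM; split => //; split => //; exact: nz.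
Qed.

Lemma computable_fsum (T : choiceType) (S : set T) (f : T -> invariants D -> R) :
    (forall i, S i -> computable (f i)) ->
    (forall M, P M -> finite_set [set i | S i /\ f i M != 0]) ->
  computable (fun M => \sum_(i \in S) f i M).
Proof.
move=> cf fin.
(* A formula is chosen for each index. [FSum] ranges over a whole type, so the terms outside [S] are
   patched by 0. *)
have cg i : {e : formula A Z | forall M, P M ->
    sound M e /\ eval M e = patch (fun=> 0) S (f ^~ M) i}.
  apply: cid; rewrite /patch; have [|_] := boolP (i \in S).
    by rewrite inE => /cf.
  exact: (computable_const 0).
exists (FSum (fun i => sval (cg i))) => M PM /=.
have eE i : eval M (sval (cg i)) = patch (fun=> 0) S (f ^~ M) i.
  by case: (cg i) => e /= he; have [] := he M PM.
split; [split|].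
- by move=> i; case: (cg i) => e /= he; have [] := he M PM.
- apply: sub_finite_set (fin M PM) => i /=; rewrite eE /patch.
  by case: ifP => [|_]; rewrite ?eqxx // inE.
- by rewrite [RHS]fsbig_mkcond; apply: eq_fsbigr => i _; exact: eE.
Qed.

Lemma computableD f g :
  computable f -> computable g -> computable (fun M => f M + g M).
Proof.
move=> cf cg.
apply: (@computable_ext
  (fun M => \sum_(b \in [set: bool]) (if b then f M else g M))).
  move=> M _; rewrite (fsbigE [:: true; false]) //=; last by case.
  by rewrite !big_cons big_nil !in_setT addr0.
apply: (@computable_fsum _ _ (fun b M => if b then f M else g M)) => [[]|M _] //.
exact: finite_finset.
Qed.

Lemma computableZ c f : computable f -> computable (fun M => c * f M).
Proof. exact/computableM/computable_const. Qed.

Lemma computableN f : computable f -> computable (fun M => - f M).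
Proof.
by move=> /(computableZ (-1)); apply: computable_ext => M _; rewrite mulN1r.
Qed.

Lemma computableB f g :
  computable f -> computable g -> computable (fun M => f M - g M).
Proof. by move=> cf /computableN; exact: computableD. Qed.

Lemma computable_sum (I : Type) (r : seq I) (Q : pred I)
    (f : I -> invariants D -> R) :
  (forall i, Q i -> computable (f i)) ->
  computable (fun M => \sum_(i <- r | Q i) f i M).
Proof.
move=> cf; elim: r => [|i r IH].
  by apply: computable_ext (computable_const 0) => M _; rewrite big_nil.
have [Qi|nQi] := boolP (Q i); last first.
  by apply: computable_ext IH => M _; rewrite big_cons (negbTE nQi).
by apply: computable_ext (computableD (cf i Qi) IH) => M _; rewrite big_cons Qi.
Qed.

Lemma computable0 f : (forall M, P M -> f M = 0) -> computable f.
Proof. by move=> f0; apply: computable_ext (computable_const 0) => M /f0. Qed.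

Lemma computable_unscale c f : c != 0 ->
  computable (fun M => c * f M) -> computable f.
Proof.
move=> c0 /(computableZ c^-1); apply: computable_ext => M _.
by rewrite mulKf.
Qed.

End Computable.

(** * Homogeneous bases and the ring H^*(X) *)

Section Grading.
Variables (F : fieldType) (V : vectType F) (m : nat) (dg : nat -> {vspace V}).
Hypothesis gr : grading m dg.

Lemma grading_le d x : x \in dg d -> x != 0 -> (d <= m)%N.
Proof.
case: gr => _ _ gt0 xd; apply: contra_neqT; rewrite -ltnNge => /gt0 d0.
by apply/eqP; rewrite -memv0 -d0.
Qed.

Lemma grading_sum x : exists2 y : 'I_m.+1 -> V,
  (forall d, y d \in dg d) & x = \sum_d y d.
Proof.
have := memvf x; have [<- _ _] := gr => /memv_sumP[y yd ->].
by exists y => // d; exact: yd.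
Qed.

Lemma grading_uniq (u v : 'I_m.+1 -> V) :
  (forall d, u d \in dg d) -> (forall d, v d \in dg d) ->
  \sum_d u d = \sum_d v d -> u =1 v.
Proof.
case: gr => _ /directv_sum_unique dir _ ud vd uv d.
have := dir u v (fun i _ => ud i) (fun i _ => vd i).
by rewrite uv eqxx => /esym/forallP/(_ d)/eqP.
Qed.

Lemma grading_sum1 d x : x \in dg d -> (d <= m)%N ->
  x = \sum_(e < m.+1) (if e == d :> nat then x else 0).
Proof.
move=> xd dm; rewrite -big_mkcond (big_pred1 (inord d)) // => i.
by rewrite -[RHS](inj_eq val_inj) /= inordK.
Qed.

Lemma grading_disjoint p q x : x \in dg p -> x \in dg q -> p != q -> x = 0.
Proof.
move=> xp xq pq; have [//|x0] := eqVneq x 0.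
have pm := grading_le xp x0; have qm := grading_le xq x0.
have := grading_sum1 xp pm; rewrite [in LHS](grading_sum1 xq qm).
move=> /grading_uniq => /(_ _ _ (inord p)); rewrite inordK // eqxx (negbTE pq).
by move=> <- // e; case: eqP => [->|_]; rewrite ?mem0v.
Qed.

(** Decomposing an element of degree [d] along the smaller pieces also decomposes it along [dg]; by
    uniqueness only the component [d] survives. *)
Lemma grading_eq (dg' : nat -> {vspace V}) : (forall d, dg' d <= dg d)%VS ->
  (\sum_(d < m.+1) dg' d)%VS = fullv -> forall d, dg d = dg' d.
Proof.
move=> le full d; apply/eqP; rewrite eqEsubv le andbT; apply/subvP => x xd.
have [->|x0] := eqVneq x 0; first exact: mem0v.
have dm := grading_le xd x0.
have := memvf x; rewrite -full => /memv_sumP[y yd].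
rewrite [in LHS](grading_sum1 xd dm) => /grading_uniq/(_ (inord d)).
rewrite inordK // eqxx => ->; last 2 first.
- by move=> e; case: eqP => [->|_]; rewrite ?mem0v.
- by move=> e; apply: (subvP (le e)); exact: yd.
by have := yd (inord d) isT; rewrite inordK.
Qed.

Variables (n : nat) (B : n.-tuple V) (deg : 'I_n -> nat).
Hypotheses (Bb : basis_of fullv B) (Bdeg : forall i, tnth B i \in dg (deg i)).

Lemma basis_tnth x : x = \sum_i coord B i x *: tnth B i.
Proof.
rewrite {1}(coord_basis Bb (memvf x)); apply: eq_bigr => i _.
by rewrite (tnth_nth 0).
Qed.

Lemma basis_coord i j : coord B i (tnth B j) = (j == i)%:R.
Proof. by rewrite (tnth_nth 0) coord_free // (basis_free Bb). Qed.

Lemma basis_neq0 i : tnth B i != 0.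
Proof.
apply/eqP => B0; have := basis_coord i i.
by rewrite B0 linear0 eqxx => /esym/eqP; rewrite oner_eq0.
Qed.

Lemma basis_deg d i : tnth B i \in dg d -> deg i = d.
Proof.
move=> Bd; apply/eqP; apply: contraNT (basis_neq0 i) => ne.
by rewrite (grading_disjoint (Bdeg i) Bd ne).
Qed.

(** Grouping the expansion of [x] by the degrees of the basis vectors gives its homogeneous
    decomposition, which is unique. *)
Lemma coord_deg d x i : x \in dg d -> coord B i x != 0 -> deg i = d.
Proof.
move=> xd cx; have x0 : x != 0 by apply: contraNneq cx => ->; rewrite linear0.
have dm := grading_le xd x0.
have degm j : (deg j < m.+1)%N by exact: grading_le (Bdeg j) (basis_neq0 j).
pose y (e : 'I_m.+1) := \sum_(j | deg j == e) coord B j x *: tnth B j.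
have yd e : y e \in dg e.
  by apply: memv_suml => j /eqP <-; apply: memvZ.
have yx : \sum_e y e = x.
  rewrite [RHS]basis_tnth (partition_big (fun j => Ordinal (degm j)) xpredT) //=.
have := yx; rewrite [in RHS](grading_sum1 xd dm) => /grading_uniq.
move=> /(_ yd) /(_ _ (Ordinal (degm i))) /= yi.
apply/eqP; apply: contraNT cx => ne; move: yi; rewrite (negbTE ne) => /(_ _).
have -> : coord B i x = coord B i (y (Ordinal (degm i))).
  rewrite /y linear_sum /= (bigD1 i) //= linearZ /= basis_coord eqxx.
  rewrite big1 => [|j /andP[_ ji]]; last first.
    by rewrite linearZ /= basis_coord (negbTE ji) mulr0.
  by rewrite addr0 mulr1.
move=> ->; rewrite ?linear0 // => e.
by case: eqP => [->|_]; rewrite ?mem0v.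
Qed.

End Grading.

(** * Cohomology generated in degree 2: evenness, products with divisors, Poincare duality *)

Section GeneratedInDegreeTwo.
Variables (R : realType) (D : topData R).
Hypothesis hgen : agenv (degX D 2) = fullv.

(** The algebra generated by U = H^2 is the line of 1 plus U times itself. So the candidate pieces
    [dg] span, and [grading_eq] identifies them with the graded pieces. *)
Lemma degX_gen : [/\ degX D 0 = 1%VS, degX D 1 = 0%VS &
  forall d, degX D d.+2 = (degX D 2 * degX D d)%VS].
Proof.
pose U := degX D 2.
pose dg d := match d with 0 => 1%VS | 1 => 0%VS | e.+2 => (U * degX D e)%VS end.
have gr := degX_grading D.
suff E : forall d, degX D d = dg d by split=> [||d]; rewrite E.
have le d : (dg d <= degX D d)%VS.
  case: d => [|[|d]] /=; rewrite ?sub0v //.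
  - by rewrite -memvE degX_one.
  - by apply/prodvP => u v uU vd; rewrite -add2n degX_mul.
apply: (grading_eq gr le); apply/eqP; rewrite eqEsubv subvf -[fullv]hgen.
rewrite /= agenvEl hgen -/U; have [<- _ gt0] := gr.
rewrite big_distrr subv_add; apply/andP; split.
  exact: (sumv_sup ord0).
apply/subv_sumP => d _.
have [lt|ge] := ltnP d.+2 (dimL D).*2.+1.
  exact: (sumv_sup (Ordinal lt)).
suff ud0 : (U * degX D d = 0)%VS by rewrite [X in (X <= _)%VS]ud0 sub0v.
by apply/eqP; rewrite -subv0 -(gt0 d.+2) //; exact: (le d.+2).
Qed.

Lemma degX_odd d : odd d -> degX D d = 0%VS.
Proof.
have [_ d1 d2] := degX_gen; elim/ltn_ind: d => -[|[|d]] IH //=.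
by rewrite negbK => /IH od; rewrite d2 od // prodv0.
Qed.

Lemma degD_even (i : 'I_(K D).+1) : ~~ odd (degD i).
Proof.
apply/negP => /degX_odd d0; have := Delta_deg i; rewrite d0 memv0.
by apply/negP/(basis_neq0 (Delta_basis D)).
Qed.

Lemma Del_comm (i j : 'I_(K D).+1) : Del i * Del j = Del j * Del i.
Proof.
rewrite [RHS](degX_comm (Delta_deg i) (Delta_deg j)) -signr_odd oddM.
by rewrite (negbTE (degD_even i)) scale1r.
Qed.

Lemma HX_comm (x y : HX D) : x * y = y * x.
Proof.
have bE := basis_tnth (Delta_basis D).
rewrite (bE x) (bE y) [LHS]mulr_suml [RHS]mulr_sumr; apply: eq_bigr => i _.
rewrite mulr_suml mulr_sumr; apply: eq_bigr => j _.
by rewrite -!scalerAl -!scalerAr !scalerA mulrC Del_comm.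
Qed.

(** The form in which generation by divisors is used throughout: [Q] will express that an invariant
    with the given class inserted is computable (or zero), and the product [Del j * Del l] is the
    one that WDVV produces. *)
Lemma degX_ind d (Q : HX D -> Prop) :
  (forall a u v, Q u -> Q v -> Q (a *: u + v)) -> Q 0 ->
  (forall j l, degD j = 2%N -> degD l = d -> Q (Del j * Del l)) ->
  forall z, z \in degX D d.+2 -> Q z.
Proof.
move=> Qlin Q0 Qb; have [_ _ ->] := degX_gen.
have Qsum (I : finType) (p : pred I) (F : I -> HX D) :
    (forall i, p i -> Q (F i)) -> Q (\sum_(i | p i) F i).
  move=> QF; elim/big_rec: _ => // i u /QF Qi Qu.
  by rewrite -[F i]scale1r; exact: Qlin.
have QZ a u : Q u -> Q (a *: u) by move=> Qu; rewrite -[_ *: _]addr0; exact: Qlin.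
pose W := (\sum_(j : 'I_(K D).+1 | degD j == 2%N)
  \sum_(l : 'I_(K D).+1 | degD l == d) <[Del j * Del l]>)%VS.
suff: ((degX D 2 * degX D d)%VS <= W)%VS.
  move=> /subvP sub z /sub /memv_sumP[y yW ->]; apply: (Qsum) => j /[dup] jE /yW.
  move=> /memv_sumP[y' yW' ->]; apply: (Qsum) => l /[dup] lE /yW' /vlineP[c ->].
  by apply/QZ/Qb; exact/eqP.
apply/prodvP => u v u2 vd; have bE := basis_tnth (Delta_basis D).
rewrite (bE u) (bE v) mulr_suml; apply: memv_suml => j _.
rewrite mulr_sumr; apply: memv_suml => l _.
rewrite -scalerAl -scalerAr scalerA.
have [->|cj] := eqVneq (coord (Delta D) j u) 0.
  by rewrite mul0r scale0r mem0v.
have [->|cl] := eqVneq (coord (Delta D) l v) 0.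
  by rewrite mulr0 scale0r mem0v.
have grd := degX_grading D.
apply: memvZ; apply/(subvP _ _ (memv_line _)).
have jE := coord_deg grd (Delta_basis D) (@Delta_deg _ D) u2 cj.
have lE := coord_deg grd (Delta_basis D) (@Delta_deg _ D) vd cl.
apply: (sumv_sup j); first by rewrite jE.
by apply: (sumv_sup l); first by rewrite lE.
Qed.

Lemma Del_deg0 (i : 'I_(K D).+1) : degD i = 0%N -> exists2 c, c != 0 & Del i = c *: 1.
Proof.
move=> i0; have := Delta_deg i; rewrite i0.
have [-> _ _] := degX_gen => /vlineP[c cE]; exists c => //.
apply: contraNneq (basis_neq0 (Delta_basis D) i) => c0.
by rewrite cE c0 scale0r.
Qed.

Definition gram : 'M[R]_((K D).+1) :=
  \matrix_(i, j) (intX D (Del i * Del j) : R).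

(** A row vector in the kernel is the coordinate vector of a class orthogonal to everything, which
    is 0 by Poincare duality. *)
Lemma gram_unit : gram \in unitmx.
Proof.
rewrite -row_free_unit -kermx_eq0; apply/eqP/matrixP => i j.
set v := row i (kermx gram).
have vg : v *m gram = 0 by rewrite -row_mul mulmx_ker row0.
pose x := \sum_k v 0 k *: Del k.
have x0 : x = 0.
  apply: poincare_duality => y; rewrite (basis_tnth (Delta_basis D) y).
  rewrite mulr_sumr linear_sum big1 // => l _.
  rewrite -scalerAr linearZ /x mulr_suml linear_sum /=.
  have := congr1 (fun w : 'rV_ _ => w 0 l) vg; rewrite !mxE => vl.
  rewrite [X in _ *: X](_ : _ = 0) ?scaler0 // -[RHS]vl; apply: eq_bigr => k _.
  by rewrite -scalerAl linearZ /= [gram _ _]mxE.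
have := coord_sum_free (v 0) j (basis_free (Delta_basis D)).
have -> : \sum_(k < (K D).+1) v 0 k *: (Delta D)`_k = x.
  by apply: eq_bigr => k _; rewrite /Del (tnth_nth 0).
by rewrite x0 linear0 !mxE => <-.
Qed.

Lemma ginv_sym i j : ginv D i j = ginv D j i.
Proof.
have gT : gram^T = gram.
  by apply/matrixP => k l; rewrite !mxE Del_comm.
suff: (ginv D)^T = ginv D by move=> /matrixP/(_ j i); rewrite !mxE.
by rewrite /ginv trmx_inv gT.
Qed.

(** This is how a constant sphere acts in WDVV: contracting its triple intersection number with the
    inverse pairing inserts the cup product into the other factor. *)
Lemma coordE (z : HX D) i :
  \sum_j ginv D i j * (intX D (z * Del j) : R) = coord (Delta D) i z.
Proof.
rewrite [in LHS](basis_tnth (Delta_basis D) z).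
under eq_bigr => j _ do rewrite mulr_suml linear_sum mulr_sumr /=.
rewrite exchange_big /=.
have E (k : 'I_(K D).+1) : \sum_j ginv D i j *
    (intX D (coord (Delta D) k z *: tnth (Delta D) k * Del j) : R) =
    coord (Delta D) k z * (k == i)%:R.
  under eq_bigr => j _ do rewrite -scalerAl linearZ /= mulrCA.
  rewrite -mulr_sumr; congr (_ * _).
  have /matrixP/(_ i k) := mulVmx gram_unit; rewrite !mxE eq_sym => <-.
  by apply: eq_bigr => j _; rewrite !mxE Del_comm.
under eq_bigr do rewrite E.
rewrite (bigD1 i) //= eqxx mulr1 big1 ?addr0 // => k /negbTE ->.
by rewrite mulr0.
Qed.

End GeneratedInDegreeTwo.

(** * Insertions and exponents *)

Section ListInsertions.
Variables (R : realType) (V : lmodType R).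

Lemma graded_symmetric_perm (T : Type) m (B : 'I_m -> T) dg (f : seq T -> R) :
  (forall i, ~~ odd (dg i)) -> graded_symmetric B dg f ->
  forall I J, perm_eq I J -> f (map B I) = f (map B J).
Proof.
move=> ev fs I J; rewrite perm_sym -[I]/(val (in_tuple I)) => /tuple_permP[s ->].
rewrite (fs _ (in_tuple I) s) -signr_odd (_ : odd _ = false).
  by rewrite expr0 mul1r -[in RHS]map_comp.
rewrite (big_morph odd oddD (erefl _)) big1 // => i _.
rewrite (big_morph odd oddD (erefl _)) big1 // => j _.
by rewrite oddM (negbTE (ev _)).
Qed.

Variables (f : seq V -> R) (mf : multilinear f).

Lemma multilinear0 s1 s2 : f (s1 ++ 0 :: s2) = 0.
Proof.
by have := mf s1 s2 1 0 0; rewrite scaler0 addr0 mul1r => /eqP;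
   rewrite -subr_eq0 opprD addNKr oppr_eq0 => /eqP.
Qed.

Lemma multilinearZ s1 s2 a x : f (s1 ++ (a *: x) :: s2) = a * f (s1 ++ x :: s2).
Proof. by rewrite -[a *: x]addr0 mf multilinear0 addr0. Qed.

Lemma multilinear_sum s1 s2 (I : Type) (r : seq I) (c : I -> R) (B : I -> V) :
  f (s1 ++ (\sum_(i <- r) c i *: B i) :: s2) =
  \sum_(i <- r) c i * f (s1 ++ B i :: s2).
Proof.
elim: r => [|i r IH]; first by rewrite !big_nil multilinear0.
by rewrite !big_cons mf IH.
Qed.

End ListInsertions.

Section Exponents.
Variables (R : realType) (D : topData R).
Implicit Types (F : Pi D -> expo D -> R) (e : expo D) (b : Pi D).

Definition expo1 (v : var D) : expo D := [ffun w => (w == v) : nat].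

Definition expo_fact e : R := \prod_v ((e v)`!)%:R.

Lemma expo_fact_neq0 e : expo_fact e != 0.
Proof. by apply/prodf_neq0 => v _; rewrite pnatr_eq0 -lt0n fact_gt0. Qed.

Lemma expo_fact1 v e : expo_fact (e + expo1 v) = (e v).+1%:R * expo_fact e.
Proof.
rewrite /expo_fact (bigD1 v) // [in RHS](bigD1 v) //= mulrA; congr (_ * _).
  by rewrite !ffunE eqxx [(_ + _)%R]addn1 factS natrM.
apply: eq_bigr => w /negbTE ne; rewrite !ffunE ne; congr (_`!%:R).
exact: addn0.
Qed.

(** With the factorials split off, [dvar] is a shift of the exponent ([dvar_egf]). *)
Definition egf F : series D := fun m => (expo_fact m.2)^-1 * F m.1 m.2.

Definition shift v F : Pi D -> expo D -> R := fun b e => F b (e + expo1 v).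

Lemma dvar_egf v F : dvar v (egf F) = egf (shift v F).
Proof.
apply/funext => -[b e]; rewrite /dvar /egf /shift /= -/(expo1 v).
rewrite expo_fact1 invfM !mulrA mulfV ?mul1r //.
by rewrite pnatr_eq0.
Qed.

Definition mexp (k : nat) (I : seq 'I_(N D).+1) : expo D :=
  [ffun v => if v is Some i then count_mem i I else k].

Lemma mexp_s k I : mexp k I + expo1 None = mexp k.+1 I.
Proof.
apply/ffunP => -[i|]; rewrite !ffunE /=; first exact: addn0.
exact: addn1.
Qed.

Lemma mexp_t k I i : mexp k I + expo1 (Some i) = mexp k (i :: I).
Proof.
apply/ffunP => -[j|]; rewrite !ffunE /=; last exact: addn0.
by rewrite eq_sym [LHS]addnC.
Qed.

Lemma mexp0 : mexp 0 [::] = 0.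
Proof. by apply/ffunP => -[i|]; rewrite !ffunE. Qed.

Lemma mexpD k k' I I' : mexp k I + mexp k' I' = mexp (k + k') (I ++ I').
Proof. by apply/ffunP => -[i|]; rewrite !ffunE ?count_cat. Qed.

Definition insertion_idx m (r : 'I_m -> nat) : seq 'I_m :=
  flatten [seq nseq (r i) i | i <- rev (enum 'I_m)].

Lemma insertionsE (T : Type) m (B : 'I_m -> T) r :
  insertions B r = map B (insertion_idx r).
Proof.
rewrite /insertions /insertion_idx map_flatten -map_comp; congr flatten.
by apply: eq_map => i /=; rewrite map_nseq.
Qed.

Lemma count_insertion_idx m (r : 'I_m -> nat) i :
  count_mem i (insertion_idx r) = r i.
Proof.
rewrite count_flatten -map_comp map_rev sumn_rev sumnE big_map big_enum /=.
rewrite (bigD1 i) //= count_nseq /= eqxx mul1n big1 ?addn0 // => j ji.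
by rewrite count_nseq /= (negbTE ji) mul0n.
Qed.

Lemma mexp_surj e : exists k I, e = mexp k I.
Proof.
exists (e None), (insertion_idx (fun i => e (Some i))).
by apply/ffunP => -[i|]; rewrite !ffunE ?count_insertion_idx.
Qed.

Lemma perm_insertion_idx m (r : 'I_m -> nat) I :
  (forall i, count_mem i I = r i) -> perm_eq (insertion_idx r) I.
Proof.
by move=> cI; apply/allP => i _; rewrite /= count_insertion_idx cI.
Qed.

End Exponents.

(** * Odd n: the case [L] = 0 and the comparison of the two bases *)

Section OddDimension.
Variables (R : realType) (D : topData R).
Hypothesis hgen : agenv (degX D 2) = fullv.
Hypothesis n_odd : odd (dimL D).

(** Integration over L only sees H^n(X), which vanishes for odd n. *)
Lemma intL_eq0 (z : HX D) : intL D z = 0.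
Proof.
have [y yd ->] := grading_sum (degX_grading D) z.
rewrite linear_sum big1 // => d _.
have [dn|/intL_deg] := eqVneq (d : nat) (dimL D); last by apply; exact: yd.
have := yd d; rewrite dn degX_odd // memv0 => /eqP ->; exact: linear0.
Qed.

Lemma L_nullT : L_null D.
Proof. by apply/asboolP; exact: intL_eq0. Qed.

Lemma N_eq : N D = (K D).+1.
Proof. by have [] := Gamma_null intL_eq0. Qed.

Lemma kappa_eq : kappa D = K D.
Proof. by rewrite /kappa N_eq; apply/minn_idPl. Qed.

Definition incl (i : 'I_(K D).+1) : 'I_(N D).+1 := inord i.

Lemma inclE i : incl i = i :> nat.
Proof. by rewrite /incl inordK // N_eq ltnS ltnW. Qed.

Lemma incl_inj : injective incl.
Proof. by move=> i j /(congr1 val); rewrite /= !inclE => /val_inj. Qed.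

Lemma incl_or_max (i : 'I_(N D).+1) : (exists j, i = incl j) \/ i = ord_max.
Proof.
have [ik|ki] := ltnP i (K D).+1.
  by left; exists (Ordinal ik); apply: val_inj; rewrite /= inclE.
right; apply: val_inj => /=; apply/anti_leq; rewrite -ltnS ltn_ord /=.
by rewrite [X in (X <= _)%N]N_eq.
Qed.

Lemma incl_neq_max i : incl i != ord_max.
Proof.
apply/eqP => /(congr1 val) /=; rewrite inclE N_eq => iE.
by have := ltn_ord i; rewrite iE ltnn.
Qed.

Lemma incl_kappa (i : 'I_(N D).+1) : (i <= kappa D)%N -> exists j, i = incl j.
Proof.
rewrite kappa_eq => ik; exists (inord i); apply: val_inj.
by rewrite /= inclE inordK.
Qed.

Lemma rel_Gam i : Defs.rel D (Gam (incl i)) = Del i.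
Proof. by apply: Gamma_rel; rewrite inclE. Qed.

Lemma Gam_max : Gam ord_max = ybd D 1.
Proof. by have [] := Gamma_null intL_eq0. Qed.

Lemma degG_incl i : degG (incl i) = degD i.
Proof.
apply/esym/(basis_deg (degX_grading D) (Delta_basis D) (@Delta_deg _ D)).
by rewrite -/(Del i) -rel_Gam rel_deg // Gamma_deg.
Qed.

Lemma degG_max : degG (@ord_max (N D)) = (dimL D).+1.
Proof.
apply: (basis_deg (degXL_grading D) (Gamma_basis D) (@Gamma_deg _ D)).
by rewrite -/(Gam _) Gam_max ybd_deg.
Qed.

Lemma degG_even (i : 'I_(N D).+1) : ~~ odd (degG i).
Proof.
have [[j ->]|->] := incl_or_max i; first by rewrite degG_incl degD_even.
by rewrite degG_max /= negbK.
Qed.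

(** The difference of the two sides is killed by [rel], hence lies in the image of [ybd], in degree
    n + 1, while it has degree 0. This gives access to the fundamental class axiom, which is stated
    for [oneXL]. *)
Lemma Gam_deg0 i : degD i = 0%N -> exists2 c, c != 0 & Gam (incl i) = c *: oneXL D.
Proof.
move=> i0; have [c c0 iE] := Del_deg0 hgen i0; exists c => //.
have /exact_XL[a aE] : Defs.rel D (Gam (incl i) - c *: oneXL D) = 0.
  by rewrite linearB linearZ /= rel_one rel_Gam iE subrr.
apply/eqP; rewrite -subr_eq0; apply/eqP.
apply: (grading_disjoint (degXL_grading D) (p := 0) (q := (dimL D).+1)) => //.
  apply: memvB; last exact/memvZ/oneXL_deg.
  by rewrite -i0 -degG_incl Gamma_deg.
by rewrite -aE -[a]mulr1 -[a * 1]/(a *: (1 : R^o)) linearZ memvZ // ybd_deg.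
Qed.

Lemma Gam_neq_one i : degG i != 0%N -> (Gam i == oneXL D) = false.
Proof.
move=> i0; apply: contraNF i0 => /eqP iE.
rewrite (basis_deg (degXL_grading D) (Gamma_basis D) (@Gamma_deg _ D) (d := 0)) //.
by rewrite -/(Gam _) iE oneXL_deg.
Qed.

Lemma P_R_Gam i : P_R (Gam (incl i)) = 0.
Proof.
rewrite /P_R L_nullT /Gam basis_coord ?Gamma_basis //.
by rewrite (negbTE (incl_neq_max _)).
Qed.

(** The lift of a cup product is a combination of the Gamma_k with k at most K, on which [P_R]
    vanishes. Hence no constant disk has two insertions from H^*(X). *)
Lemma P_R_wedge i j : P_R (wedge (Gam (incl i)) (Gam (incl j))) = 0.
Proof.
rewrite /wedge !P_R_Gam mul0r mulr0 addr0 scale0r addr0 /split_lift.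
rewrite /P_R L_nullT linear_sum big1 // => k _.
have := P_R_Gam k; rewrite /P_R L_nullT linearZ /= => ->.
by rewrite mulr0.
Qed.

End OddDimension.

Arguments incl {R D} i.

(** * Closed invariants *)

Lemma sum_neq0 (R : nmodType) (I : finType) (F : I -> R) :
  \sum_i F i != 0 -> exists i, F i != 0.
Proof.
move=> nz; apply/existsP; apply: contraNT nz => /existsPn F0.
by rewrite big1 // => i _; apply/eqP; have := F0 i; rewrite negbK.
Qed.

Section ClosedInvariants.
Local Open Scope classical_set_scope.
Variables (R : realType) (D : topData R).
Hypothesis hgen : agenv (degX D 2) = fullv.
Implicit Types (x : H2X D) (M : invariants D) (I : seq 'I_(K D).+1).
Implicit Types (a b c e : 'I_(K D).+1).

Local Notation om x := (omega D (varpi x)).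
Local Notation coordD i z := (coord (Delta D) i z).

Lemma varpi0 : varpi (0 : H2X D) = 0.
Proof. by rewrite /varpi !raddf0. Qed.

Lemma varpiD x y : varpi (x + y) = varpi x + varpi y.
Proof. by rewrite /varpi !raddfD. Qed.

Lemma energy0 : om (0 : H2X D) = 0.
Proof. by rewrite varpi0 raddf0. Qed.

Lemma energyD x y : om (x + y) = om x + om y.
Proof. by rewrite varpiD raddfD. Qed.

Section ClosedSplittings.
Variables (M : invariants D) (hM : closed_axioms M).

Lemma gw_perm x I J : perm_eq I J -> GW M x (map Del I) = GW M x (map Del J).
Proof. by apply: (graded_symmetric_perm (degD_even hgen)) => //; exact: gw_sym. Qed.

Lemma gw_energy x s : x != 0 -> GW M x s != 0 -> hbar D <= om x.
Proof. by move=> x0; apply: contraNT; rewrite -ltNge => /(gw_gap hM) ->. Qed.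

Lemma gw_energy_ge0 x s : GW M x s != 0 -> 0 <= om x.
Proof.
have [->|x0] := eqVneq x 0; first by rewrite energy0.
by move=> /(gw_energy x0); apply: le_trans; exact/ltW/hbar_gt0.
Qed.

Lemma gw_deg0 x i I : x != 0 -> degD i = 0%N -> GW M x (map Del (i :: I)) = 0.
Proof.
move=> x0 /(Del_deg0 hgen)[c _ cE] /=.
rewrite cE (multilinearZ (gw_linear hM x) [::]) /= gw_fundamental //.
by case: I => [|j [|k [|]]]; rewrite ?(negbTE x0) mulr0.
Qed.

(** The divisor axiom summed over the expansion of the symplectic class. Read from right to left it
    adds an insertion at the cost of dividing by the energy, which is positive, whereas the integral
    of a single divisor may be 0. *)
Lemma gw_divisor_energy x I : x != 0 ->
  \sum_j coordD j (Defs.rel D (symp D)) * GW M x (map Del (rcons I j)) =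
  om x * GW M x (map Del I).
Proof.
move=> x0; transitivity
  (\sum_j coordD j (Defs.rel D (symp D)) * (pairX x (Del j) * GW M x (map Del I))).
  apply: eq_bigr => j _.
  have [->|cj] := eqVneq (coordD j (Defs.rel D (symp D))) 0; first by rewrite !mul0r.
  rewrite map_rcons gw_divisor //; last by left.
  apply: (coord_deg (degX_grading D) (Delta_basis D) (@Delta_deg _ D) _ cj).
  by rewrite rel_deg // symp_deg.
rewrite /varpi -symp_pair pair_compat [in RHS](basis_tnth (Delta_basis D) (Defs.rel D _)).
rewrite linear_sum mulr_suml; apply: eq_bigr => j _.
by rewrite linearZ /= mulrA.
Qed.

Definition gw_split a b c e I (p : H2X D * H2X D) : R :=
  \sum_(m : (size I).-tuple bool) \sum_i \sum_j
    GW M p.1 ([:: Del a; Del b; Del i] ++ map Del (mask m I)) * ginv D i j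
    * GW M p.2 ([:: Del j; Del c; Del e] ++ map Del (mask (map negb m) I)).

Lemma gw_split_neq0 a b c e I p : gw_split a b c e I p != 0 ->
  exists s s', [/\ GW M p.1 s != 0, GW M p.2 s' != 0 &
    exists m : (size I).-tuple bool, exists i,
      s = [:: Del a; Del b; Del i] ++ map Del (mask m I)].
Proof.
move=> /sum_neq0[m /sum_neq0[i /sum_neq0[j]]].
rewrite !mulf_eq0 !negb_or => /andP[/andP[n1 _] n2].
by do 2!eexists; split; [exact: n1 | exact: n2 | exists m, i].
Qed.

(** The second factor has nonnegative energy, so the first class has energy at most that of [x];
    Gromov compactness applies for each of the finitely many insertions. *)
Lemma gw_split_finite a b c e I x :
  finite_set [set p | p.1 + p.2 = x /\ gw_split a b c e I p != 0].
Proof.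
pose Y (t : (size I).-tuple bool * 'I_(K D).+1) :=
  [set y | GW M y ([:: Del a; Del b; Del t.2] ++ map Del (mask t.1 I)) != 0 /\
           om y <= om x].
have YF : finite_set (\bigcup_(t in [set: _]) Y t).
  by apply: bigcup_finite => [|t _]; [exact: finite_finset | exact: gw_finite].
apply: sub_finite_set (finite_image (fun y => (y, x - y)) YF) => -[y z] /=.
move=> [yz /gw_split_neq0 /= [s [s' [n1 n2 [m [i sE]]]]]].
exists y; last by rewrite -yz addrC addKr.
exists (m, i) => //; split; first by rewrite /= -[_ :: _]sE.
by rewrite -yz energyD lerDl (gw_energy_ge0 n2).
Qed.

Lemma mask_eq_nil (T : Type) (m : bitseq) (s : seq T) :
  size m = size s -> mask m s = [::] -> m = nseq (size s) false.
Proof.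
elim: s m => [|y s IH] [|[] m] //= [sm] ms.
by rewrite {1}(IH m sm ms).
Qed.

(** A constant sphere has exactly three insertions, so only the empty mask contributes. *)
Lemma gw_split0l a b c e I x :
  gw_split a b c e I (0, x) =
  \sum_j coordD j (Del a * Del b) * GW M x (map Del [:: j, c, e & I]).
Proof.
rewrite /gw_split (bigD1 (nseq_tuple (size I) false)) //= [X in _ + X]big1 ?addr0; last first.
  move=> m mI; apply: big1 => i _; apply: big1 => j _.
  rewrite -[[:: _, _, _ & _]]/(map Del [:: a, b, i & mask m I]) gw_zero //.
  case E: (mask m I) => [|y s]; last by rewrite !mul0r.
  case/eqP: mI; apply: val_inj => /=; apply: mask_eq_nil => //.
  by rewrite size_tuple.
rewrite exchange_big /=; apply: eq_bigr => j _.
rewrite -mulr_suml; congr (_ * _); last first.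
  by rewrite map_nseq mask_true.
rewrite -(coordE hgen); apply: eq_bigr => i _; rewrite mask_false /=.
rewrite -[[:: _; _; _]]/(map Del [:: a; b; i]) gw_zero //.
by rewrite (ginv_sym hgen) mulrC.
Qed.

Lemma gw_split0r a b c e I x :
  gw_split a b c e I (x, 0) =
  \sum_i coordD i (Del c * Del e) * GW M x (map Del [:: a, b, i & I]).
Proof.
rewrite /gw_split (bigD1 (nseq_tuple (size I) true)) //= [X in _ + X]big1 ?addr0; last first.
  move=> m mI; apply: big1 => i _; apply: big1 => j _.
  rewrite -[X in _ * GW M 0 X]/(map Del [:: j, c, e & mask (map negb m) I]) gw_zero //.
  case E: (mask (map negb m) I) => [|y s]; last by rewrite !mulr0.
  case/eqP: mI; apply: val_inj => /=.
  rewrite -[val m](mapK negbK) (mask_eq_nil _ E) ?map_nseq //.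
  by rewrite size_map size_tuple.
apply: eq_bigr => i _; rewrite -(coordE hgen) mulr_suml; apply: eq_bigr => j _.
rewrite map_nseq mask_false mask_true //=.
rewrite -[X in _ * GW M 0 X]/(map Del [:: j; c; e]) gw_zero //.
rewrite (_ : Del j * Del c * Del e = Del c * Del e * Del j).
  by rewrite -[LHS]mulrA mulrC.
by rewrite -[LHS]mulrA (HX_comm hgen).
Qed.

Definition inner_splittings x : set (H2X D * H2X D) :=
  [set p | p.1 + p.2 = x /\ p.1 != 0 /\ p.2 != 0].

Lemma gw_WDVV_leading x a b c e I : x != 0 ->
  \sum_(p \in [set p : H2X D * H2X D | p.1 + p.2 = x]) gw_split a b c e I p =
  \sum_j coordD j (Del a * Del b) * GW M x (map Del [:: j, c, e & I]) +
  \sum_i coordD i (Del c * Del e) * GW M x (map Del [:: a, b, i & I]) +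
  \sum_(p \in inner_splittings x) gw_split a b c e I p.
Proof.
move=> x0; have fin := gw_split_finite a b c e I x.
rewrite (fsbigD1S (x := (0, x))) //=; last by rewrite add0r.
rewrite gw_split0l -addrA; congr (_ + _).
rewrite (fsbigD1S (x := (x, 0))) /=; first last.
- by apply: sub_finite_set fin => p [[]].
- split; first by rewrite addr0.
  by apply/eqP => -[/eqP]; rewrite (negbTE x0).
rewrite gw_split0r; congr (_ + _); apply: eq_fsbigl.
apply/predeqP => -[y z] /=; rewrite !xpair_eqE; split.
  move=> [[yz n0] n1]; rewrite -yz in n0 n1; split=> //=; split.
    by apply: contraNneq n0 => ->; rewrite add0r !eqxx.
  by apply: contraNneq n1 => ->; rewrite addr0 !eqxx.
move=> [/= yz [y0 z0]]; rewrite /inner_splittings (negbTE y0) (negbTE z0) andbF.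
by split.
Qed.

End ClosedSplittings.
End ClosedInvariants.

(** * Reconstruction of the closed invariants from three-point ones *)

Section ClosedReconstruction.
Local Open Scope classical_set_scope.
Variables (R : realType) (D : topData R).
Hypothesis hgen : agenv (degX D 2) = fullv.
Variables (P : invariants D -> Prop) (A Z : set (value D)).
Hypothesis hP : forall M, P M -> closed_axioms M.
Hypothesis hA : forall v, @initial_closed R D v -> A v.
Implicit Types (x : H2X D) (M : invariants D) (I : seq 'I_(K D).+1).
Implicit Types (a b c e : 'I_(K D).+1) (z : HX D).

Local Notation comp := (computable P A Z).
Local Notation om x := (omega D (varpi x)).
Local Notation coordD i z := (coord (Delta D) i z).

Definition gw_computable x I := comp (fun M => GW M x (map Del I)).

Lemma gw_computable_perm x I J :
  perm_eq I J -> gw_computable x I -> gw_computable x J.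
Proof. by move=> pIJ; apply: computable_ext => M /hP hM; exact: gw_perm. Qed.

(** [Q z] stands for the computability of an invariant with [z] as one insertion, expanded in the
    basis; it is the property to which [degX_ind] is applied. *)
Lemma computable_coord_sum (F : 'I_(K D).+1 -> invariants D -> R) :
  let Q z := comp (fun M => \sum_i coordD i z * F i M) in
  [/\ forall u (y z : HX D), Q y -> Q z -> Q (u *: y + z), Q 0 &
      forall i, Q (Del i) -> comp (F i)].
Proof.
move=> Q; split=> [u y z Qy Qz||i].
- apply: computable_ext (computableD (computableZ u Qy) Qz) => M _.
  rewrite mulr_sumr -big_split; apply: eq_bigr => i _ /=.
  by rewrite linearP mulrDl mulrA.
- by apply: computable0 => M _; rewrite big1 // => i _; rewrite linear0 mul0r.
apply: computable_ext => M _.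
rewrite (bigD1 i) //= basis_coord ?Delta_basis // eqxx mul1r big1 ?addr0 //.
move=> j ji; rewrite basis_coord ?Delta_basis //.
by rewrite eq_sym (negbTE ji) mul0r.
Qed.

Lemma gw_computable3 x i j l : degD l = 2%N -> gw_computable x [:: i; j; l].
Proof.
move=> l2.
have [dim|ndim] := eqVneq ((dimL D).*2%:Z + 2 * chern D x) (degD i + degD j + 2)%N%:Z.
  apply: (@computable_val _ _ P A Z (ClosedValue x [:: Del i; Del j; Del l])).
  apply: hA; exists x, (degD i), (degD j), (Del i), (Del j), (Del l).
  by split=> //; rewrite -?l2; exact: Delta_deg.
apply: computable0 => M /hP hM; apply/eqP; apply: contraNT ndim => nz.
have := gw_degree hM nz; rewrite !big_cons big_nil /= l2 => h.
by apply/eqP; lia.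
Qed.

(** A nonzero term has both factors of energy at least [hbar], so both stay below [E]. *)
Lemma gw_inner_computable x a b c e I (E : R) : om x < E + hbar D ->
  (forall y J, om y < E -> gw_computable y J) ->
  comp (fun M => \sum_(p \in inner_splittings x) gw_split M a b c e I p).
Proof.
move=> xE IH; apply: computable_fsum => [[y z] /= [yz [y0 z0]]|M PM]; last first.
  have fin := gw_split_finite (hP PM) a b c e I x.
  by apply: sub_finite_set fin => p [[]].
apply: computable_sum => m _; apply: computable_sum => i _.
apply: computable_sum => j _.
have [yh|yh] := ltP (om y) (hbar D).
  apply: computable0 => M /hP hM; rewrite (gw_gap hM) ?mul0r //.
have [zh|zh] := ltP (om z) (hbar D).
  apply: computable0 => M /hP hM; rewrite [X in _ * X](gw_gap hM) ?mulr0 //.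
move: xE; rewrite -yz energyD => xE.
apply: computableM; first apply: computableM; last 1 first.
- by apply: (IH z [:: j, c, e & mask (map negb m) I]); lra.
- by apply: (IH y [:: a, b, i & mask m I]); lra.
- exact: computable_const.
Qed.

Lemma gw_WDVV_computable x a b c e I (E : R) : x != 0 -> om x < E + hbar D ->
  (forall y J, om y < E -> gw_computable y J) ->
  comp (fun M =>
    (\sum_j coordD j (Del a * Del b) * GW M x (map Del [:: j, c, e & I]) +
     \sum_i coordD i (Del c * Del e) * GW M x (map Del [:: a, b, i & I])) -
    (\sum_j coordD j (Del a * Del c) * GW M x (map Del [:: j, b, e & I]) +
     \sum_i coordD i (Del b * Del e) * GW M x (map Del [:: a, c, i & I]))).
Proof.
move=> x0 xE IH.
have c1 := gw_inner_computable a b c e I xE IH.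
have c2 := gw_inner_computable a c b e I xE IH.
apply: computable_ext (computableB c2 c1) => M /hP hM.
have ev : all (fun i => ~~ odd (degD i)) [:: a, b, c, e & I].
  by apply/allP => i _; exact: degD_even.
have := gw_WDVV hM x ev; rewrite /= -!/(gw_split _ _ _ _ _ _ _).
rewrite (gw_WDVV_leading hgen hM) // (gw_WDVV_leading hgen hM) //.
by move/eqP; rewrite -subr_eq0 => /eqP h; apply/eqP; rewrite -subr_eq0 -oppr_eq0 -[X in _ == X]h; apply/eqP; ring.
Qed.

(** For three or more insertions, induction on their number and then on the degree of the first one.
    Written as a divisor [j] times a class [l] of smaller degree, it is a leading term of WDVV; of
    the three other leading terms two contain the divisor [j] and the third can be reordered to
    start with [l]. *)
Lemma gw_step x (E : R) : om x < E + hbar D ->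
  (forall y J, om y < E -> gw_computable y J) -> forall I, gw_computable x I.
Proof.
move=> xE IH I.
have [->|x0] := eqVneq x 0.
  apply: (@computable_ext _ _ _ _ _ (fun=> if I is [:: i; j; l]
    then (intX D (Del i * Del j * Del l) : R) else 0)).
    2: exact: computable_const.
  move=> M /hP hM.
  by rewrite gw_zero.
have [xh|hx] := ltP (om x) (hbar D).
  by apply: computable0 => M /hP hM; rewrite (gw_gap hM).
(* Fewer than three insertions are reached from three by adding the symplectic class and dividing by
   the energy. *)
have down J : (forall j, degD j = 2%N -> gw_computable x (rcons J j)) ->
    gw_computable x J.
  move=> cj; apply: (@computable_unscale _ _ _ _ _ (om x)).
    by rewrite gt_eqF // (lt_le_trans (hbar_gt0 D)).
  apply: (@computable_ext _ _ _ _ _ (fun M =>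
    \sum_j coordD j (Defs.rel D (symp D)) * GW M x (map Del (rcons J j)))).
    by move=> M /hP hM; rewrite gw_divisor_energy.
  apply: computable_sum => j _.
  have [->|nz] := eqVneq (coordD j (Defs.rel D (symp D))) 0.
    by apply: computable0 => M _; rewrite mul0r.
  apply/computableZ/cj.
  apply: (coord_deg (degX_grading D) (Delta_basis D) (@Delta_deg _ D) _ nz).
  by rewrite rel_deg // symp_deg.
have s2 J : size J = 2%N -> gw_computable x J.
  case: J => [|i [|j []]] // _; apply: down => l; exact: gw_computable3.
have s1 J : size J = 1%N -> gw_computable x J.
  by move=> J1; apply: down => l _; apply: s2; rewrite size_rcons J1.
have s0 J : size J = 0%N -> gw_computable x J.
  by move=> J1; apply: down => l _; apply: s1; rewrite size_rcons J1.
have [m] := ubnP (size I); elim: m I => // m IHm I; rewrite ltnS => sIm.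
have div2 j J : degD j = 2%N -> size (j :: J) = size I -> gw_computable x (j :: J).
  move=> j2 JI; apply: (@gw_computable_perm x (rcons J j)).
    by rewrite perm_rcons.
  have [J2|J2] := eqVneq (size J) 2%N.
    by move: J J2 {JI} => [|i [|l []]] // _; exact: gw_computable3.
  apply: (computable_ext (f := fun M => pairX x (Del j) * GW M x (map Del J))).
    move=> M /hP hM; rewrite map_rcons gw_divisor //; right; exact/eqP.
  by apply/computableZ/IHm; rewrite -JI in sIm.
have [lt|] := ltnP (size I) 3.
  by case: (size I) (s0 I) (s1 I) (s2 I) lt => [|[|[|]]] // h0 h1 h2 _; auto.
case: I sIm div2 => [|i [|c [|e I]]] //= sIm div2 _.
have [d] := ubnP (degD i); elim: d i c e => // d IHd i c e; rewrite ltnS => id.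
case E0 : (degD i) (degD_even hgen i) => [|[|r]] // _.
  by apply: computable0 => M /hP hM; exact: gw_deg0.
case: r E0 => [|r] E0; first exact: div2.
have [Qlin Q0 Qi] := computable_coord_sum
  (fun j M => GW M x (map Del [:: j, c, e & I])).
apply: (Qi); apply: (degX_ind hgen Qlin Q0 (d := r.+1)); last first.
  by rewrite -E0; exact: Delta_deg.
move=> j l j2 lr.
have cW := gw_WDVV_computable j l c e I x0 xE IH.
have c1 : comp (fun M =>
    \sum_i coordD i (Del c * Del e) * GW M x (map Del [:: j, l, i & I])).
  by apply: computable_sum => k _; apply/computableZ/div2.
have c2 : comp (fun M =>
    \sum_i coordD i (Del l * Del e) * GW M x (map Del [:: j, c, i & I])).
  by apply: computable_sum => k _; apply/computableZ/div2.
have c3 : comp (fun M =>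
    \sum_i coordD i (Del j * Del c) * GW M x (map Del [:: i, l, e & I])).
  apply: computable_sum => k _; apply/computableZ.
  apply: (@gw_computable_perm x [:: l, k, e & I]).
    by apply/seq.permP => q /=; rewrite addnCA.
  apply: IHd; rewrite lr; rewrite E0 in id; exact: leq_trans id.
apply: computable_ext (computableB (computableD (computableD cW c2) c3) c1) => M _.
by ring.
Qed.

Lemma gw_all_computable x I : gw_computable x I.
Proof.
have [m] : exists m, om x < m%:R * hbar D.
  have := archi_boundP (x := `|om x| / hbar D).
  rewrite divr_ge0 // ?ltW ?hbar_gt0 // => /(_ isT).
  rewrite ltr_pdivrMr ?hbar_gt0 // => h; eexists; apply: le_lt_trans h.
  exact: ler_norm.
elim: m x I => [|m IH] x I xm; last first.
  by apply: (gw_step (E := m%:R * hbar D)) => //; rewrite -addn1 natrD mulrDl mul1r in xm.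
apply: computable0 => M /hP hM; apply/eqP; apply: contraTT xm => nz.
by rewrite mul0r -leNgt (gw_energy_ge0 hM nz).
Qed.

End ClosedReconstruction.

(** * Coefficients of the potentials *)

Section Splittings.
Local Open Scope classical_set_scope.
Variables (R : realType) (D : topData R).
Implicit Types (b : Pi D) (e : expo D) (f g : series D).

Lemma finite_expo_splittings e : finite_set [set q : expo D * expo D | q.1 + q.2 = e].
Proof.
pose m := (\sum_v e v)%N.
pose T := ({ffun var D -> 'I_m.+1} * {ffun var D -> 'I_m.+1})%type.
pose h (t : T) : expo D * expo D := ([ffun v => t.1 v : nat], [ffun v => t.2 v : nat]).
have TF : finite_set [set: T] by exact: finite_finset.
apply: sub_finite_set (finite_image h TF) => -[q r] /= qr.
have qm v : (q v + r v <= m)%N.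
  by rewrite /m (bigD1 v) //= -qr ffunE leq_addr.
have qv v : (q v < m.+1)%N by rewrite ltnS (leq_trans _ (qm v)) ?leq_addr.
have rv v : (r v < m.+1)%N by rewrite ltnS (leq_trans _ (qm v)) ?leq_addl.
exists ([ffun v => Ordinal (qv v)], [ffun v => Ordinal (rv v)]) => //.
by congr pair; apply/ffunP => v; rewrite !ffunE.
Qed.

Definition energy_finite f := forall e (E : R),
  finite_set [set b | f (b, e) != 0 /\ omega D b <= E].

Definition energy_nonneg f := forall b e, f (b, e) != 0 -> 0 <= omega D b.

Lemma smul_finite f g m : energy_finite f -> energy_nonneg g ->
  finite_set [set p : (Pi D * expo D) * (Pi D * expo D) |
    p.1 + p.2 = m /\ f p.1 * g p.2 != 0].
Proof.
case: m => b e fF g0.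
pose h (q : expo D * expo D) (y : Pi D) := ((y, q.1), (b - y, q.2)).
have UF : finite_set (\bigcup_(q in [set q : expo D * expo D | q.1 + q.2 = e])
    (h q @` [set y | f (y, q.1) != 0 /\ omega D y <= omega D b])).
  by apply: bigcup_finite => [|q _]; [exact: finite_expo_splittings | exact: finite_image].
apply: sub_finite_set UF => -[[b1 e1] [b2 e2]] /= [[b12 e12]].
rewrite mulf_eq0 negb_or => /andP[n1 n2].
exists (e1, e2) => //; exists b1; last by rewrite /h -b12 addrC addKr.
by split=> //=; rewrite -b12 raddfD lerDl (g0 _ _ n2).
Qed.

Lemma smulC f g m : smul f g m = smul g f m.
Proof.
rewrite /smul (reindex_fsbig (fun p => (p.2, p.1)) [set p | p.1 + p.2 = m]) /=.
  by apply: eq_fsbigr => p _; rewrite mulrC.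
split=> [[p q] /= <-|[p q] [p' q'] _ _ /= [-> ->]|[p q] /= pq] //.
  by rewrite addrC.
by exists (q, p) => //=; rewrite addrC.
Qed.

(* When [g] is a third derivative of Phi, its constant term is the cup product  *)
(* (constant spheres), and the terms left here have spheres of positive energy. *)
Definition smul_tail f g m : R :=
  \sum_(p \in [set p : (Pi D * expo D) * (Pi D * expo D) | p.1 + p.2 = m]
              `&` [set p | p != (m, 0)]) f p.1 * g p.2.

Lemma smul_head f g m : energy_finite f -> energy_nonneg g ->
  smul f g m = f m * g 0 + smul_tail f g m.
Proof.
move=> fF g0; rewrite /smul (fsbigD1S (x := (m, 0))) //=; first by rewrite addr0.
exact: smul_finite.
Qed.

End Splittings.

Section PotentialCoefficients.
Local Open Scope classical_set_scope.
Variables (R : realType) (D : topData R).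
Hypothesis hgen : agenv (degX D 2) = fullv.
Hypothesis n_odd : odd (dimL D).
Implicit Types (b : Pi D) (e : expo D) (I : seq 'I_(N D).+1) (J : seq 'I_(K D).+1).
Implicit Types (i j : 'I_(K D).+1).

Lemma ord_leN (j : 'I_(K D).+1) : (j <= N D)%N.
Proof. by rewrite (N_eq hgen n_odd) ltnW ?ltn_ord. Qed.

Definition tv i : var D := Some (incl i).

Definition Omega_num (M : invariants D) b e : R :=
  if 0 <= omega D b then
    OGW M b (e None) (insertions Gam (fun i : 'I_(N D).+1 => e (Some i))) else 0.

Lemma Omega_egf M : Omega M = egf (Omega_num M).
Proof.
apply/funext => -[b e]; rewrite /Omega /egf /Omega_num /=.
by case: ifP; rewrite ?mulr0.
Qed.

Definition Phi_num (M : invariants D) b e : R :=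
  if (e None == 0%N) &&
     [forall i : 'I_(N D).+1, (K D < i)%N ==> (e (Some i) == 0%N)]
  then \sum_(x \in [set x : H2X D | varpi x = b])
    (-1) ^+ (ws D x : nat) * GW M x (insertions Del
       [ffun j : 'I_(K D).+1 => if (j <= N D)%N then e (tvar D j) else 0%N])
  else 0.

Lemma expo_fact_closed e : e None = 0%N -> e (Some ord_max) = 0%N ->
  expo_fact (R := R) e = \prod_j ((e (tv j))`!)%:R.
Proof.
move=> es em; rewrite /expo_fact (bigID (fun v => v \in codom tv)) /=.
rewrite [X in _ * X]big1 ?mulr1; last first.
  case=> [i|] ni; last by rewrite es.
  have [[j ij]|->] := incl_or_max hgen n_odd i; last by rewrite em.
  by case/negP: ni; rewrite ij; exact: codom_f.
have tv_inj : injective tv by move=> i j [] /(incl_inj hgen n_odd).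
have ci i : tv i \in codom tv by exact: codom_f.
rewrite (reindex_omap tv (fun v => if v is Some i then Some (inord i) else None)).
  apply: eq_bigl => i; rewrite ci /=.
  by apply/eqP; congr Some; apply: val_inj; rewrite /= (inclE hgen n_odd) inordK.
by move=> v /codomP[i ->] /=; rewrite (inclE hgen n_odd) inord_val.
Qed.

Lemma Phi_egf M : Phi M = egf (Phi_num M).
Proof.
apply/funext => -[b e]; rewrite /Phi /egf /Phi_num /=.
case: ifP => [/andP[/eqP es /forallP em]|]; rewrite ?mulr0 //.
rewrite /closed_potential; congr (_^-1 * _).
have em0 : e (Some ord_max) = 0%N.
  apply/eqP; apply: (implyP (em ord_max)).
  by rewrite /= (N_eq hgen n_odd).
rewrite expo_fact_closed //; apply: eq_bigr => j _.
by rewrite ffunE ord_leN.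
Qed.

Definition Phi_class (M : invariants D) b J : R :=
  \sum_(x \in [set x : H2X D | varpi x = b])
    (-1) ^+ (ws D x : nat) * GW M x (map Del J).

Section ClosedAxioms.
Variables (M : invariants D) (hC : closed_axioms M).

Lemma Phi_num_list b J : Phi_num M b (mexp 0 (map incl J)) = Phi_class M b J.
Proof.
rewrite /Phi_num ffunE /= ifT; last first.
  apply/forallP => i; apply/implyP => Ki; rewrite ffunE.
  apply/eqP/count_memPn; apply/negP => /mapP[j _ ij].
  by move: Ki; rewrite ij (inclE hgen n_odd) ltnNge -ltnS ltn_ord.
apply: eq_fsbigr => x _; congr (_ * _); rewrite insertionsE.
apply: (gw_perm hgen hC); apply: perm_insertion_idx => j.
rewrite ffunE ord_leN -[tvar D j]/(tv j) ffunE /= count_map; apply: eq_count => k /=.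
by rewrite (inj_eq (incl_inj hgen n_odd)).
Qed.

Lemma Phi_num_cases e :
  (exists J, e = mexp 0 (map incl J)) \/ forall M' b, Phi_num M' b e = 0.
Proof.
have [k [I ->]] := mexp_surj e; case: k => [|k]; last first.
  by right=> M' b; rewrite /Phi_num ffunE.
have [mI|nI] := boolP (ord_max \in I).
  right=> M' b; rewrite /Phi_num ifF //; apply/negP => /andP[_ /forallP/(_ ord_max)].
  rewrite /= {1}(N_eq hgen n_odd) leqnn ffunE /= => /eqP/count_memPn.
  by rewrite mI.
left; exists (map (fun i : 'I_(N D).+1 => inord i) I); congr mexp.
rewrite -map_comp -[LHS]map_id; apply/eq_in_map => i iI /=.
have [[j ->]|im] := incl_or_max hgen n_odd i.
  by rewrite (inclE hgen n_odd) inord_val.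
by rewrite im (negbTE nI) in iI.
Qed.

Lemma Phi_class_neq0 b J : Phi_class M b J != 0 ->
  exists2 x, varpi x = b & GW M x (map Del J) != 0.
Proof.
move=> /fsum_neq0[x xb]; rewrite mulf_eq0 signr_eq0 /= => nz.
by exists x.
Qed.

Lemma Phi_num_energy b e : Phi_num M b e != 0 ->
  (b == 0) || (hbar D <= omega D b).
Proof.
have [[J ->]|->] := Phi_num_cases e; last by rewrite eqxx.
rewrite Phi_num_list => /Phi_class_neq0[x <-].
have [->|x0] := eqVneq x 0; first by rewrite varpi0 eqxx.
by move=> /(gw_energy hC x0) ->; rewrite orbT.
Qed.

(** A spherical class over 0 has energy 0, so the gap leaves only the class 0. *)
Lemma Phi_num0 J : Phi_num M 0 (mexp 0 (map incl J)) = GW M 0 (map Del J).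
Proof.
rewrite Phi_num_list /Phi_class (@fsbig_neq0_sub _ _ _ _ [set 0]).
- by rewrite fsbig_set1 raddf0 mul1r.
- by move=> x ->; rewrite /= varpi0.
move=> x /= xb; rewrite mulf_eq0 signr_eq0 /= => nx.
apply/eqP; apply: contraNT nx => x0; apply/eqP.
by apply: (gw_gap hC) => //; rewrite xb raddf0 hbar_gt0.
Qed.

End ClosedAxioms.

Section OpenAxioms.
Variables (M : invariants D) (hM : frobenius_superpotential M).

Lemma ogw_perm b k I I' : 0 <= omega D b -> perm_eq I I' ->
  OGW M b k (map Gam I) = OGW M b k (map Gam I').
Proof.
by move=> b0; apply: (graded_symmetric_perm (degG_even hgen n_odd)); exact: ogw_sym.
Qed.

Lemma Omega_num_list b k I : 0 <= omega D b ->
  Omega_num M b (mexp k I) = OGW M b k (map Gam I).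
Proof.
move=> b0; rewrite /Omega_num b0 ffunE insertionsE; apply: ogw_perm => //.
by apply: perm_insertion_idx => i; rewrite ffunE.
Qed.

Lemma Omega_num_neg b e : omega D b < 0 -> Omega_num M b e = 0.
Proof. by move=> b0; rewrite /Omega_num leNgt b0. Qed.

Lemma Omega_num_ge0 b e : Omega_num M b e != 0 -> 0 <= omega D b.
Proof. by apply: contraNT; rewrite -ltNge => /Omega_num_neg ->. Qed.

Lemma Omega_num_energy b e : Omega_num M b e != 0 ->
  (b == 0) || (hbar D <= omega D b).
Proof.
move=> nz; have b0 := Omega_num_ge0 nz.
have [k [I eI]] := mexp_surj e; move: nz; rewrite eI Omega_num_list // => nz.
case: eqP => // /eqP b1 /=; apply: contraNT nz; rewrite -ltNge => bh.
by rewrite (ogw_gap hM) // eqxx.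
Qed.

Lemma Omega_num_finite e (E : R) :
  finite_set [set b | Omega_num M b e != 0 /\ omega D b <= E].
Proof.
have [_ /(_ e E)] := Omega_novikov hM; apply: sub_finite_set => b /= [nz bE].
by split=> //; rewrite Omega_egf /egf mulf_neq0 // invr_eq0 expo_fact_neq0.
Qed.

(** Under this condition the energy gap puts all terms of the second derivative of Omega at energy
    at least [hbar]. It fails for s together with a class of degree 0, because of the value -1 in
    the fundamental class axiom. *)
Definition no_constant_disk v w :=
  forall e, Omega_num M 0 (e + expo1 v + expo1 w) = 0.

Lemma no_constant_disk_sym v w : no_constant_disk v w -> no_constant_disk w v.
Proof. by move=> vw e; rewrite -addrA [expo1 w + _]addrC addrA vw. Qed.

Lemma omega0_ge0 : 0 <= omega D 0 :> R.
Proof. by rewrite raddf0. Qed.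

Lemma no_constant_disk_tt i j : no_constant_disk (tv i) (tv j).
Proof.
move=> e; have [k [I ->]] := mexp_surj e.
rewrite !mexp_t Omega_num_list ?omega0_ge0 // ogw_zero //.
by case: I => //; case: ifP => // _; exact: P_R_wedge.
Qed.

Lemma no_constant_disk_ss : no_constant_disk None None.
Proof.
move=> e; have [k [I ->]] := mexp_surj e.
rewrite !mexp_s Omega_num_list ?omega0_ge0 // ogw_zero //.
by case: I => [|i [|j []]].
Qed.

Lemma no_constant_disk_ts i : degD i != 0%N -> no_constant_disk (tv i) None.
Proof.
move=> i0 e; have [k [I ->]] := mexp_surj e.
rewrite mexp_t mexp_s Omega_num_list ?omega0_ge0 // ogw_zero //.
case: I => [|j []] //.
by rewrite Gam_neq_one ?andbF // degG_incl.
Qed.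

Lemma ogw_deg0 b k i I : 0 <= omega D b -> b != 0 -> degD i = 0%N ->
  OGW M b k (map Gam (incl i :: I)) = 0.
Proof.
move=> b0 nb /(Gam_deg0 hgen n_odd)[c _ cE] /=.
rewrite cE (multilinearZ (ogw_linear hM _ b0) [::]) /= ogw_fundamental //.
by case: I => [|j []]; rewrite ?(negbTE nb) mulr0.
Qed.

End OpenAxioms.
End PotentialCoefficients.

(** * The open WDVV equations: cup product terms and energy of the other terms *)

Section OpenWDVV.
Local Open Scope classical_set_scope.
Variables (R : realType) (D : topData R).
Hypothesis hgen : agenv (degX D 2) = fullv.
Hypothesis n_odd : odd (dimL D).
Implicit Types (b : Pi D) (e : expo D) (m : Pi D * expo D) (u v w : var D).
Implicit Types (i j k l : 'I_(K D).+1).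

Local Notation coordD i z := (coord (Delta D) i z).

Lemma mexp_inj h h' (I I' : seq 'I_(N D).+1) :
  mexp h I = mexp h' I' -> h = h' /\ perm_eq I I'.
Proof.
move=> E; split; first by move/ffunP/(_ None): E; rewrite !ffunE.
by apply/allP => i _ /=; move/ffunP/(_ (Some i)): E; rewrite !ffunE => ->.
Qed.

Definition dOmega (M : invariants D) v w : series D := dvar v (dvar w (Omega M)).

Definition dPhi (M : invariants D) u v w : series D :=
  dvar u (dvar v (dvar w (Phi M))).

Lemma dOmegaE M v w b e :
  dOmega M v w (b, e) = (expo_fact e)^-1 * Omega_num M b (e + expo1 v + expo1 w).
Proof. by rewrite /dOmega Omega_egf !dvar_egf. Qed.

Lemma dPhiE M u v w b e : dPhi M u v w (b, e) =
  (expo_fact e)^-1 * Phi_num M b (e + expo1 u + expo1 v + expo1 w).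
Proof. by rewrite /dPhi (Phi_egf hgen n_odd) !dvar_egf. Qed.

Definition closed_open (M : invariants D) u v w m : R :=
  \sum_i \sum_j ginv D i j * smul (dOmega M u (tv i)) (dPhi M v w (tv j)) m.

Definition closed_open_tail (M : invariants D) u v w m : R :=
  \sum_i \sum_j ginv D i j * smul_tail (dOmega M u (tv i)) (dPhi M v w (tv j)) m.

Definition open_open (M : invariants D) u v u' v' m : R :=
  smul (dOmega M u v) (dOmega M u' v') m.

Section FixM.
Variables (M : invariants D).
Hypotheses (hC : closed_axioms M) (hM : frobenius_superpotential M).

Lemma contract_closed_open u v w m :
  contract (fun i : nat => dvar u (dvar (tvar D i) (Omega M)))
           (fun j : nat => dvar v (dvar w (dvar (tvar D j) (Phi M)))) m
  = closed_open M u v w m.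
Proof.
rewrite /contract kappa_eq //; apply: eq_bigr => i _; apply: eq_bigr => j _.
by rewrite !inord_val.
Qed.

Lemma contract_open_closed u v w m :
  contract (fun i : nat => dvar v (dvar w (dvar (tvar D i) (Phi M))))
           (fun j : nat => dvar u (dvar (tvar D j) (Omega M))) m
  = closed_open M u v w m.
Proof.
rewrite /contract kappa_eq // exchange_big; apply: eq_bigr => i _ /=.
by apply: eq_bigr => j _; rewrite !inord_val smulC ginv_sym.
Qed.

Lemma WDVV_ttt u v w m :
  closed_open M u v w m - open_open M u None v w m =
  closed_open M w u v m - open_open M u v None w m.
Proof.
have [/(_ u v w m) + _] := ogw_WDVV hM.
by rewrite contract_closed_open contract_open_closed.
Qed.

Lemma WDVV_tts u v m :
  - open_open M u None v None m =
  closed_open M None u v m - open_open M u v None None m.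
Proof.
have [_ /(_ u v m)] := ogw_WDVV hM.
by rewrite contract_open_closed.
Qed.

Lemma dOmega_finite v w : energy_finite (dOmega M v w).
Proof.
move=> e E; apply: sub_finite_set (Omega_num_finite hM (e + expo1 v + expo1 w) E).
move=> b /=; rewrite dOmegaE mulf_eq0 negb_or => -[/andP[_ ->] bE].
by split.
Qed.

Lemma dOmega_nonneg v w : energy_nonneg (dOmega M v w).
Proof.
move=> b e; rewrite dOmegaE mulf_eq0 negb_or => /andP[_].
exact: Omega_num_ge0.
Qed.

Lemma dPhi_energy u v w b e : dPhi M u v w (b, e) != 0 ->
  (b == 0) || (hbar D <= omega D b).
Proof.
rewrite dPhiE mulf_eq0 negb_or => /andP[_].
exact: Phi_num_energy.
Qed.

Lemma energy_nonneg0 b : (b == 0) || (hbar D <= omega D b) -> 0 <= omega D b.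
Proof.
case/orP => [/eqP ->|]; first by rewrite raddf0.
by apply: le_trans; exact/ltW/hbar_gt0.
Qed.

Lemma dPhi_nonneg u v w : energy_nonneg (dPhi M u v w).
Proof. by move=> b e /dPhi_energy/energy_nonneg0. Qed.

Lemma expo_fact0 : expo_fact (0 : expo D) = 1 :> R.
Proof. by rewrite /expo_fact big1 // => v _; rewrite ffunE. Qed.

Lemma dPhi_head i j l :
  dPhi M (tv i) (tv j) (tv l) 0 = intX D (Del i * Del j * Del l).
Proof.
rewrite dPhiE expo_fact0 invr1 mul1r -mexp0 !mexp_t.
rewrite -[[:: _; _; _]]/(map incl [:: l; j; i]) Phi_num0 // gw_zero //.
by congr (intX D _); rewrite (HX_comm hgen _ (Del i)) (HX_comm hgen (Del l)) mulrA.
Qed.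

Lemma closed_open_head u i j b e :
  closed_open M u (tv i) (tv j) (b, e) =
  (expo_fact e)^-1 *
    \sum_k coordD k (Del i * Del j) * Omega_num M b (e + expo1 u + expo1 (tv k))
  + closed_open_tail M u (tv i) (tv j) (b, e).
Proof.
rewrite /closed_open mulr_sumr -big_split; apply: eq_bigr => k _ /=.
rewrite -(coordE hgen) mulr_suml mulr_sumr -big_split; apply: eq_bigr => l _ /=.
rewrite (smul_head _ (@dOmega_finite _ _) (@dPhi_nonneg _ _ _)) mulrDr.
congr (_ + _); rewrite dOmegaE dPhi_head.
by rewrite -!mulrA [LHS]mulrCA [X in _ = _ * (_ * X)]mulrC.
Qed.

Lemma dOmega_energy u v b e : no_constant_disk M u v ->
  dOmega M u v (b, e) != 0 -> hbar D <= omega D b.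
Proof.
move=> nc; rewrite dOmegaE mulf_eq0 negb_or => /andP[_ nz].
case/orP: (Omega_num_energy hgen n_odd hM nz) => [/eqP b0|//].
by rewrite b0 nc eqxx in nz.
Qed.

(** At class 0 the zero axiom allows exactly three insertions. The three derivatives use them up,
    which forces [e = 0]. *)
Lemma dPhi_tail_energy i j l b e : (b, e) != 0 ->
  dPhi M (tv i) (tv j) (tv l) (b, e) != 0 -> hbar D <= omega D b.
Proof.
move=> be nz; case/orP: (dPhi_energy nz) => [/eqP b0|//].
case/eqP: be; suff -> : e = 0 by rewrite b0.
move: nz.
rewrite b0 dPhiE mulf_eq0 negb_or => /andP[_].
have [h [I ->]] := mexp_surj e; rewrite !mexp_t.
have [[J JE]|->] := Phi_num_cases hgen n_odd (mexp h [:: incl l, incl j, incl i & I]);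
  last by rewrite eqxx.
rewrite JE Phi_num0 // gw_zero //.
have [-> /perm_size] := mexp_inj JE; rewrite size_map.
case: J JE => [|? [|? [|? []]]] JE //=; rewrite ?eqxx //.
by case: I JE => // _ _; rewrite mexp0.
Qed.

Lemma closed_tail_energy u i j k l m p :
  p.1 + p.2 = m -> p != (m, 0) ->
  dOmega M u (tv k) p.1 * dPhi M (tv i) (tv j) (tv l) p.2 != 0 ->
  hbar D <= omega D p.2.1.
Proof.
case: p => -[b1 e1] [b2 e2] /= pm pn; rewrite mulf_eq0 negb_or => /andP[_ n2].
apply: dPhi_tail_energy n2; apply: contraNneq pn => p2.
by rewrite -pm p2 addr0.
Qed.

Lemma closed_open_term_energy u i j k l m p : no_constant_disk M u (tv k) ->
  p.1 + p.2 = m -> p != (m, 0) ->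
  dOmega M u (tv k) p.1 * dPhi M (tv i) (tv j) (tv l) p.2 != 0 ->
  hbar D <= omega D p.1.1 /\ hbar D <= omega D p.2.1.
Proof.
move=> nc pm pn nz; split; last exact: (closed_tail_energy pm pn nz).
move: nz; case: p {pm pn} => -[b1 e1] p2; rewrite mulf_eq0 negb_or => /andP[n1 _].
exact: dOmega_energy n1.
Qed.

Lemma open_open_term_energy u v u' v' p :
  no_constant_disk M u v -> no_constant_disk M u' v' ->
  dOmega M u v p.1 * dOmega M u' v' p.2 != 0 ->
  hbar D <= omega D p.1.1 /\ hbar D <= omega D p.2.1.
Proof.
case: p => -[b1 e1] [b2 e2] nc nc' /=; rewrite mulf_eq0 negb_or => /andP[n1 n2].
by split; [exact: dOmega_energy n1 | exact: dOmega_energy n2].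
Qed.

Section LowEnergy.
Variables (b : Pi D) (e : expo D).
Hypothesis b_low : omega D b < hbar D + hbar D.

Lemma low_energy_splitting p : p.1 + p.2 = (b, e) ->
  ~ (hbar D <= omega D p.1.1 /\ hbar D <= omega D p.2.1).
Proof.
case: p => -[b1 e1] [b2 e2] /= [b12 _] [h1 h2].
by move: b_low; rewrite -b12 raddfD /= ltNge lerD.
Qed.

Lemma closed_open_tail_low u i j : (forall k, no_constant_disk M u (tv k)) ->
  closed_open_tail M u (tv i) (tv j) (b, e) = 0.
Proof.
move=> nc; rewrite /closed_open_tail big1 // => k _; rewrite big1 // => l _.
rewrite /smul_tail fsbig1 ?mulr0 // => p [/= pm pn].
apply/eqP; apply: contrapT => /negP nz; apply: (low_energy_splitting pm).
exact: closed_open_term_energy (nc k) pm pn nz.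
Qed.

Lemma open_open_low u v u' v' :
  no_constant_disk M u v -> no_constant_disk M u' v' ->
  open_open M u v u' v' (b, e) = 0.
Proof.
move=> nc nc'; rewrite /open_open /smul fsbig1 // => p /= pm.
apply/eqP; apply: contrapT => /negP nz; apply: (low_energy_splitting pm).
exact: open_open_term_energy nz.
Qed.

End LowEnergy.
End FixM.
End OpenWDVV.

(** * The leading disk *)

Section LeadingDisk.
Variables (R : realType) (D : topData R).
Hypothesis hgen : agenv (degX D 2) = fullv.
Implicit Types (b : Pi D).

Definition classXL b : H2XL D := sval (cid (qPi_surj b)).

Lemma classXLE b : qPi D (classXL b) = b.
Proof. by rewrite /classXL; case: cid. Qed.

(** The degree axiom modulo 2: the Maslov index is even, the insertions come from H^*(X) and are
    even, and k = 0, so n - 3 is even. *)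
Lemma dimL_odd (M : invariants D) b I : frobenius_superpotential M ->
  0 <= omega D b -> all (fun i : 'I_(N D).+1 => (i <= kappa D)%N) I ->
  OGW M b 0 (map Gam I) != 0 -> odd (dimL D).
Proof.
move=> hM b0 /allP Ik /(ogw_degree hM b0).
have ev : ~~ odd (\sum_(i <- I) degG i)%N.
  rewrite big_seq (big_morph odd oddD (erefl _)) big1 // => i /Ik ik.
  apply/negP => od.
  have ik' : (i < (K D).+1)%N by rewrite ltnS (leq_trans ik) // geq_minl.
  have := rel_deg (Gamma_deg i).
  rewrite (@Gamma_rel _ D i (Ordinal ik')) // degX_odd // memv0.
  exact/negP/(basis_neq0 (Delta_basis D)).
have /dvdzP[q qE] := mu_even b.
rewrite /open_deg qE; set s := (\sum_(i <- I) _)%N in ev *.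
by lia.
Qed.

Hypothesis n_odd : odd (dimL D).
Implicit Types (i j : 'I_(K D).+1) (J : seq 'I_(K D).+1).
Local Notation coordD i z := (coord (Delta D) i z).

Lemma ogw_divisor_cons (M : invariants D) b k (i : 'I_(N D).+1) I :
  frobenius_superpotential M -> 0 <= omega D b -> degG i = 2%N ->
  OGW M b k (map Gam (i :: I)) =
  pairXL (classXL b) (Gam i) * OGW M b k (map Gam I).
Proof.
move=> hM b0 i2.
have := @ogw_divisor _ _ _ hM (classXL b) k I i.
rewrite classXLE => /(_ b0 i2) <-; rewrite -map_rcons.
by apply: ogw_perm => //; rewrite perm_sym perm_rcons.
Qed.

Section FixM.
Variables (M : invariants D).
Hypotheses (hC : closed_axioms M) (hM : frobenius_superpotential M).

Lemma no_constant_disk_st i : degD i != 0%N -> no_constant_disk M None (tv i).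
Proof. by move=> i0; apply/no_constant_disk_sym/no_constant_disk_ts. Qed.

(** Two factors of energy at least [hbar] do not fit below [2 * hbar], so WDVV becomes linear: the
    factor [Del j] moves from one insertion to another. *)
Lemma WDVV_low b e i j l : omega D b < hbar D + hbar D ->
  degD i != 0%N -> degD l != 0%N ->
  \sum_k coordD k (Del j * Del l) * Omega_num M b (e + expo1 (tv i) + expo1 (tv k)) =
  \sum_k coordD k (Del i * Del j) * Omega_num M b (e + expo1 (tv l) + expo1 (tv k)).
Proof.
move=> bl i0 l0.
have tt a a' := no_constant_disk_tt hgen n_odd hM a a'.
have ts := no_constant_disk_ts hgen n_odd hM i0.
have st := no_constant_disk_st l0.
have := WDVV_ttt hgen n_odd hM (tv i) (tv j) (tv l) (b, e).
rewrite (open_open_low hgen n_odd hM e bl ts (tt j l)).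
rewrite (open_open_low hgen n_odd hM e bl (tt i j) st).
move=> /(canRL (subrK _)); rewrite addr0 subr0 => /esym.
rewrite (closed_open_head hgen n_odd hC hM (tv i)).
rewrite (closed_open_head hgen n_odd hC hM (tv l)).
rewrite (closed_open_tail_low hgen n_odd hC hM e bl _ _ (tt i)).
rewrite (closed_open_tail_low hgen n_odd hC hM e bl _ _ (tt l)).
rewrite [LHS]addr0 [RHS]addr0 => /esym.
by move/(mulfI _); apply; rewrite invr_eq0 expo_fact_neq0.
Qed.

Variable b' : Pi D.
Hypothesis b'_hbar : omega D b' = hbar D.

Let b'_gt0 : 0 < omega D b'. Proof. by rewrite b'_hbar hbar_gt0. Qed.

Let b'_ge0 : 0 <= omega D b'. Proof. exact: ltW. Qed.

Let b'_neq0 : b' != 0.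
Proof. by apply: contraTneq b'_gt0 => ->; rewrite raddf0 ltxx. Qed.

Lemma minimal_length_incl h J : minimal_length M h -> (size J < h)%N ->
  OGW M b' 0 (map Gam (map incl J)) = 0.
Proof.
move=> mh Jh; apply: mh => //; first by rewrite size_map.
apply/allP => _ /mapP[i _ ->]; rewrite (kappa_eq hgen n_odd) (inclE hgen n_odd).
by rewrite -ltnS ltn_ord.
Qed.

(* At energy hbar the quadratic terms of WDVV vanish, so that two insertions    *)
(* can be merged: the hypothesis l' > 1 of the theorem is contradictory.        *)
Lemma ogw_minimal_long J : (1 < size J)%N -> minimal_length M (size J) ->
  OGW M b' 0 (map Gam (map incl J)) = 0.
Proof.
case: J => [|i [|c J]] //= _ mJ.
have div j J' : degD j = 2%N -> (size J' <= (size J).+1)%N ->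
    OGW M b' 0 (map Gam (map incl (j :: J'))) = 0.
  move=> j2 sJ'; rewrite map_cons ogw_divisor_cons // ?degG_incl //.
  by rewrite (minimal_length_incl mJ) ?mulr0 // ltnS.
have [c0|c0] := eqVneq (degD c) 0%N.
  rewrite -!map_cons (@ogw_perm _ D hgen n_odd _ hM _ _ _ (map incl (c :: i :: J))) //.
    exact: ogw_deg0.
  by apply: perm_map; apply/seq.permP => q /=; rewrite addnCA.
case E : (degD i) (degD_even hgen i) => [|[|[|d]]] // _.
- exact: (ogw_deg0 hgen n_odd hM 0 (map incl (c :: J)) b'_ge0 b'_neq0 E).
- exact: (div i (c :: J)).
pose F k := OGW M b' 0 (map Gam (map incl [:: k, c & J])).
suff : \sum_k coordD k (Del i) * F k = 0.
  rewrite (bigD1 i) //= basis_coord ?Delta_basis // eqxx mul1r big1 ?addr0 //.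
  move=> j ji; rewrite basis_coord ?Delta_basis //.
  by rewrite eq_sym (negbTE ji) mul0r.
have iE : Del i \in degX D d.+3 by rewrite -E; exact: Delta_deg.
move: (Del i) iE; apply: degX_ind => // [u y z Qy Qz||j l j2 ld].
- transitivity (u * (\sum_k coordD k y * F k) + \sum_k coordD k z * F k).
    rewrite mulr_sumr -big_split; apply: eq_bigr => k _ /=.
    by rewrite linearP mulrDl mulrA.
  by rewrite Qy Qz mulr0 addr0.
- by rewrite big1 // => k _; rewrite linear0 mul0r.
have := @WDVV_low b' (mexp 0 (map incl J)) j l c.
rewrite b'_hbar ltrDl hbar_gt0 j2 => /(_ isT isT c0).
under [X in X = _ -> _]eq_bigr do rewrite !mexp_t Omega_num_list //.
under [X in _ = X -> _]eq_bigr do rewrite !mexp_t Omega_num_list //.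
move=> <-; apply: big1 => k _.
rewrite (@ogw_perm _ D hgen n_odd _ hM _ _ _ (map incl (j :: k :: J))) //.
  by rewrite div ?mulr0.
by apply/seq.permP => q /=; rewrite addnCA.
Qed.

End FixM.
End LeadingDisk.

(** * Division by a Novikov series *)

Lemma finite_positive_bound (R : realType) (T : choiceType) (S : set T) (f : T -> R) :
  finite_set S -> (forall x, S x -> 0 < f x) ->
  exists2 r, 0 < r & forall x, S x -> r <= f x.
Proof.
move=> /finite_seqP[s ->]; elim: s => [|y s IH] f0; first by exists 1.
have [|r r0 rf] := IH; first by move=> x xs; apply: f0; rewrite /= inE xs orbT.
have fy : 0 < f y by apply: f0; rewrite /= inE eqxx.
exists (Num.min r (f y)); first by rewrite lt_min r0.
move=> x /=; rewrite inE => /orP[/eqP ->|/rf rx]; first by rewrite ge_min lexx orbT.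
by rewrite ge_min rx.
Qed.

(* The energies at which [a] is nonzero are finite in number below any bound,   *)
(* but they depend on [M], so a formula cannot solve [a * b = c] by induction   *)
(* on the energy.  The geometric series for 1/a is a formula, and for each [M]  *)
(* only finitely many of its terms are nonzero.                                 *)
Section GeometricSeries.
Local Open Scope classical_set_scope.
Variables (R : realType) (D : topData R).
Variables (P : invariants D -> Prop) (A Z : set (value D)).
Local Notation comp := (computable P A Z).
Implicit Types (g : Pi D) (M : invariants D).

Variables (a b c : Pi D -> invariants D -> R) (h E r : R) (v0 : value D).
Hypothesis hb : forall M g, P M -> b g M != 0 -> h <= omega D g.
Hypothesis ha : forall M g, P M -> a g M != 0 -> g = 0 \/ 0 < omega D g.
Hypothesis fa : forall M F, P M -> finite_set [set g | a g M != 0 /\ omega D g <= F].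
Hypothesis abc : forall M g, P M -> omega D g < E ->
  \sum_(y \in [set: Pi D]) a y M * b (g - y) M = c g M.
Hypothesis ca : forall g, omega D g + h < E -> comp (a g).
Hypothesis cc : forall g, omega D g < E -> comp (c g).
Hypothesis r0 : r != 0.
Hypothesis Zv0 : Z v0.
Hypothesis a0 : forall M, P M -> a 0 M = r * val_of M v0.
Hypothesis v0_neq0 : forall M, P M -> val_of M v0 != 0.

(** The [y] other than 0 for which [a y] and [b (g - y)] can both be nonzero. *)
Definition window g : set (Pi D) :=
  [set y | 0 < omega D y /\ h <= omega D (g - y)].

(** Convolution with the positive energy part of [a], divided by [- a 0]. The equation [a * b = c]
    becomes [b = c / a 0 + geo_step b]. *)
Definition geo_step (f : Pi D -> invariants D -> R) g M : R :=
  - (a 0 M)^-1 * \sum_(y \in window g) a y M * f (g - y) M.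

(** The cut-off at [h] gives the terms the same lower energy bound as [b]. *)
Definition geo_term j : Pi D -> invariants D -> R :=
  iter j geo_step (fun g M => if h <= omega D g then c g M / a 0 M else 0).

Definition geo_rest j : Pi D -> invariants D -> R := iter j geo_step b.

Lemma window_finite f g M : P M ->
  finite_set [set y | window g y /\ a y M * f (g - y) M != 0].
Proof.
move=> PM; apply: sub_finite_set (fa (omega D g - h) PM) => y /= [[_ hy]].
rewrite mulf_eq0 negb_or => /andP[n _]; split=> //.
by move: hy; rewrite raddfB; lra.
Qed.

Lemma a0_neq0 M : P M -> a 0 M != 0.
Proof. by move=> PM; rewrite a0 // mulf_neq0 // v0_neq0. Qed.

Lemma geo_stepD f1 f2 f g M : P M ->
  (forall y, window g y -> f (g - y) M = f1 (g - y) M + f2 (g - y) M) ->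
  geo_step f g M = geo_step f1 g M + geo_step f2 g M.
Proof.
move=> PM fE; rewrite /geo_step -mulrDr -fsbig_splitS; try exact: window_finite.
congr (_ * _); apply: eq_fsbigr => y; rewrite inE => /fE ->.
by rewrite mulrDr.
Qed.

Lemma geo_rec0 g M : P M -> h <= omega D g -> omega D g < E ->
  b g M = geo_term 0 g M + geo_rest 1 g M.
Proof.
move=> PM hg gE; rewrite /geo_term /geo_rest /= /geo_step hg.
apply: (mulfI (a0_neq0 PM)); rewrite mulrDr mulrCA divff ?a0_neq0 // mulr1.
rewrite mulrA mulrN divff ?a0_neq0 // mulN1r -(abc PM gE).
rewrite (fsbigD1S (x := 0)) //=; last first.
  apply: sub_finite_set (fa (omega D g - h) PM) => y /= [_].
  rewrite mulf_eq0 negb_or => /andP[n /(hb PM)]; rewrite raddfB => hy.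
  by split=> //; lra.
rewrite subr0 (@fsbig_neq0_sub _ _ _ _ (window g)) ?addrK //.
  move=> y [y0 _]; split=> //=; apply: contraTneq y0 => ->.
  by rewrite raddf0 ltxx.
move=> y [_ /= y0]; rewrite mulf_eq0 negb_or => /andP[n /(hb PM) hy].
by case: (ha PM n) => [/eqP|]; first by rewrite (negbTE y0).
Qed.

Lemma geo_rec j g M : P M -> h <= omega D g -> omega D g < E ->
  geo_rest j g M = geo_term j g M + geo_rest j.+1 g M.
Proof.
move=> PM; elim: j g => [|j IH] g hg gE; first exact: geo_rec0.
apply: geo_stepD => // y [y0 hy]; apply: IH => //.
by rewrite raddfB; lra.
Qed.

Lemma geo_sum j g M : P M -> h <= omega D g -> omega D g < E ->
  b g M = \sum_(i < j) geo_term i g M + geo_rest j g M.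
Proof.
move=> PM hg gE; elim: j => [|j IH]; first by rewrite big_ord0 add0r.
by rewrite big_ord_recr /= -addrA -geo_rec.
Qed.

(** For a fixed [M] only finitely many classes of positive energy occur in [a] below the bound; [e]
    bounds their energies from below, and each step uses up at least [e]. *)
Lemma geo_iter_gap f M g0 : P M ->
  (forall g, f g M != 0 -> h <= omega D g) ->
  exists2 e, 0 < e & forall j g, omega D g <= omega D g0 ->
    iter j geo_step f g M != 0 -> h + j%:R * e <= omega D g.
Proof.
move=> PM fh; pose S := [set y | a y M != 0 /\ omega D y <= omega D g0 - h]
  `&` [set y | 0 < omega D y].
have SF : finite_set S by apply: sub_finite_set (fa (omega D g0 - h) PM) => y [].
have [y []//|e e0 eS] := finite_positive_bound (f := omega D) SF.
exists e => // j; elim: j => [|j IH] g gg; first by rewrite mul0r addr0; exact: fh.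
rewrite iterS mulf_eq0 negb_or => /andP[_ /fsum_neq0[y [y0 hy]]].
rewrite mulf_eq0 negb_or => /andP[ny nj]; move: (hy); rewrite raddfB => hy'.
have ey : e <= omega D y by apply: eS; split=> //=; split=> //; lra.
have := IH (g - y); rewrite raddfB => /(_ _ nj).
by rewrite -addn1 natrD mulrDl mul1r; lra.
Qed.

Lemma geo_series g M : P M -> h <= omega D g -> omega D g < E ->
  finite_set [set j | geo_term j g M != 0] /\
  b g M = \sum_(j \in [set: nat]) geo_term j g M.
Proof.
move=> PM hg gE.
have [|e1 e1_0 t0] := @geo_iter_gap
  (fun g M => if h <= omega D g then c g M / a 0 M else 0) M g PM.
  by move=> y; case: ifP => // _; rewrite eqxx.
have [|e2 e2_0 s0] := @geo_iter_gap b M g PM; first by move=> y; exact: hb.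
pose e := Num.min e1 e2; have e0 : 0 < e by rewrite lt_min e1_0.
(* From this [n] on, the terms and the rest would need more energy than [g] has, so they vanish. *)
have [n ne] : exists n, omega D g - h < n%:R * e.
  exists (Num.bound `|(omega D g - h) / e|); rewrite -ltr_pdivrMr //.
  exact: le_lt_trans (ler_norm _) (archi_boundP (normr_ge0 _)).
have big f e' j : e <= e' -> (n <= j)%N ->
    (f != 0 -> h + j%:R * e' <= omega D g) -> f = 0 :> R.
  move=> ee nj fh; apply/eqP; apply: contrapT => /negP /fh.
  have : n%:R * e <= j%:R * e' by apply: ler_pM; rewrite ?ler_nat // ltW.
  lra.
have tz j : (n <= j)%N -> geo_term j g M = 0.
  by move=> nj; apply: (big _ e1 j) => //; [rewrite ge_min lexx | exact: t0].
have sz : geo_rest n g M = 0.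
  by apply: (big _ e2 n) => //; [rewrite ge_min lexx orbT | exact: s0].
have sub : [set j | geo_term j g M != 0] `<=` `I_n.
  by move=> j /=; apply: contraNT; rewrite -leqNgt => /tz ->.
split; first exact: sub_finite_set sub (finite_II n).
rewrite (geo_sum n PM hg gE) sz addr0 (fsbig_ord _ _ (fun j => geo_term j g M)).
apply: fsbig_widen => // j [_ /= jn]; apply: tz.
by rewrite leqNgt; apply/negP.
Qed.

(** In the window [y] has energy at most that of [g] minus [h], where [ca] applies, and [g - y] has
    less energy than [g]. *)
Lemma geo_term_computable j g : omega D g < E -> comp (geo_term j g).
Proof.
have inv f : comp f -> comp (fun M => f M / a 0 M).
  move=> cf; apply: computable_ext (computableZ r^-1 (computable_div Zv0 v0_neq0 cf)).
  by move=> M PM; rewrite a0 // invfM mulrCA mulrA mulrC mulrA.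
elim: j g => [|j IH] g gE.
  rewrite /geo_term /=; have [hg|hg] := boolP (h <= omega D g); last exact: computable_const.
  exact/inv/cc.
have cs : comp (fun M => \sum_(y \in window g) a y M * geo_term j (g - y) M).
  apply: computable_fsum => [y [y0 hy]|M PM]; last exact: window_finite.
  rewrite raddfB in hy; apply: computableM.
    by apply: ca; lra.
  by apply: IH; rewrite raddfB; lra.
apply: computable_ext (computableN (inv _ cs)) => M PM.
by rewrite /geo_term iterS /geo_step mulNr mulrC.
Qed.

Lemma geometric_computable g : omega D g < E -> comp (b g).
Proof.
move=> gE; have [hg|gh] := leP h (omega D g); last first.
  apply: computable0 => M PM; apply/eqP; apply: contraTT gh => nz.
  by rewrite -leNgt (hb PM nz).
apply: (computable_ext (f := fun M => \sum_(j \in [set: nat]) geo_term j g M)).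
  by move=> M PM; have [_ ->] := geo_series PM hg gE.
apply: (computable_fsum (f := fun j => geo_term j g)) => [j _|M PM].
  exact: geo_term_computable.
have [fin _] := geo_series PM hg gE.
by apply: sub_finite_set fin => j [].
Qed.

End GeometricSeries.

(** * Open invariants *)

Section OpenReconstruction.
Local Open Scope classical_set_scope.
Variables (R : realType) (D : topData R).
Hypothesis hgen : agenv (degX D 2) = fullv.
Hypothesis n_odd : odd (dimL D).
Variables (P : invariants D -> Prop) (A Z : set (value D)).
Hypothesis hPC : forall M, P M -> closed_axioms M.
Hypothesis hPO : forall M, P M -> frobenius_superpotential M.
Hypothesis hAC : forall v, @initial_closed R D v -> A v.
Hypothesis hAB : forall v, @initial_boundary R D v -> A v.
Hypothesis hAI : forall v, @initial_interior R D v -> A v.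
Implicit Types (b : Pi D) (e : expo D) (M : invariants D) (u v w : var D).
Implicit Types (i j l : 'I_(K D).+1) (J : seq 'I_(K D).+1).

Local Notation comp := (computable P A Z).
Local Notation coordD i z := (coord (Delta D) i z).

Lemma Phi_num_computable b e : comp (fun M => Phi_num M b e).
Proof.
have [[J ->]|e0] := Phi_num_cases hgen n_odd e; last exact: computable0.
apply: (computable_ext (f := fun M => Phi_class M b J)).
  by move=> M /hPC hM; rewrite Phi_num_list.
apply: computable_fsum => [x _|M /hPC hM].
  by apply: computableZ; exact: (gw_all_computable hgen Z hPC hAC x J).
apply: sub_finite_set (gw_finite hM (map Del J) (omega D b)) => x /= [<-].
by rewrite mulf_eq0 signr_eq0 => nz; split.
Qed.

Lemma dPhi_computable u v w p : comp (fun M => dPhi M u v w p).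
Proof.
case: p => b e; apply: (computable_ext (f := fun M => (expo_fact e)^-1 *
    Phi_num M b (e + expo1 u + expo1 v + expo1 w))).
  by move=> M _; rewrite dPhiE.
exact/computableZ/Phi_num_computable.
Qed.

Lemma dOmega_computable u v b e : comp (fun M => Omega_num M b (e + expo1 u + expo1 v)) ->
  comp (fun M => dOmega M u v (b, e)).
Proof.
move=> /(computableZ (expo_fact e)^-1); apply: computable_ext => M _.
by rewrite dOmegaE.
Qed.

Definition no_constant_disk_all u v := forall M, P M -> no_constant_disk M u v.

Lemma open_open_finite M u v u' v' m (S : set _) : P M ->
  S `<=` [set p : (Pi D * expo D) * (Pi D * expo D) | p.1 + p.2 = m] ->
  finite_set [set p | S p /\ dOmega M u v p.1 * dOmega M u' v' p.2 != 0].
Proof.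
move=> /hPO hM Sm.
have fin := smul_finite m (dOmega_finite hM u v)
  (@dOmega_nonneg _ _ M u' v').
by apply: sub_finite_set fin => p [/Sm pm nz].
Qed.

Lemma open_open_part_computable u v u' v' m (S : set _) :
  S `<=` [set p : (Pi D * expo D) * (Pi D * expo D) | p.1 + p.2 = m] ->
  no_constant_disk_all u v -> no_constant_disk_all u' v' ->
  (forall p, S p -> hbar D <= omega D p.1.1 -> hbar D <= omega D p.2.1 ->
     comp (fun M => dOmega M u v p.1) /\ comp (fun M => dOmega M u' v' p.2)) ->
  comp (fun M => \sum_(p \in S) dOmega M u v p.1 * dOmega M u' v' p.2).
Proof.
move=> Sm nc nc' cS; apply: computable_fsum => [p Sp|M PM]; last first.
  exact: open_open_finite PM Sm.
have [[h1 h2]|no] := pselect (hbar D <= omega D p.1.1 /\ hbar D <= omega D p.2.1).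
  by have [c1 c2] := cS p Sp h1 h2; exact: computableM.
apply: computable0 => M PM; apply/eqP; apply: contrapT => /negP nz; apply: no.
exact: (open_open_term_energy hgen n_odd (hPO PM) (nc M PM) (nc' M PM) nz).
Qed.

Lemma open_open_computable u v u' v' m :
  no_constant_disk_all u v -> no_constant_disk_all u' v' ->
  (forall p, p.1 + p.2 = m -> hbar D <= omega D p.1.1 -> hbar D <= omega D p.2.1 ->
     comp (fun M => dOmega M u v p.1) /\ comp (fun M => dOmega M u' v' p.2)) ->
  comp (fun M => open_open M u v u' v' m).
Proof.
by move=> nc nc' cS; apply: (open_open_part_computable (m := m) _ nc nc' cS).
Qed.

(* Constant disks do occur in the open factor (d_s d_1 Omega has constant term  *)
(* -1), but they are harmless: the energy of the sphere is positive.            *)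
Lemma closed_open_tail_computable u i j m :
  (forall l p, p.1 + p.2 = m -> hbar D <= omega D p.2.1 ->
     comp (fun M => dOmega M u (tv l) p.1)) ->
  comp (fun M => closed_open_tail M u (tv i) (tv j) m).
Proof.
move=> cS; apply: computable_sum => k _; apply: computable_sum => l _.
apply/computableZ/computable_fsum => [p [/= pm pn]|M PM]; last first.
  have fin := smul_finite m (dOmega_finite (hPO PM) u (tv k))
    (@dPhi_nonneg _ _ hgen n_odd _ (hPC PM) (tv i) (tv j) (tv l)).
  by apply: sub_finite_set fin => p [[]].
have [h2|no] := pselect (hbar D <= omega D p.2.1).
  by apply: computableM; [exact: cS pm h2 | exact: dPhi_computable].
apply: computable0 => M PM; apply/eqP; apply: contrapT => /negP nz; apply: no.
exact: (closed_tail_energy hgen n_odd (hPC PM) pm pn nz).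
Qed.

Definition ogw_computable b k I := comp (fun M => OGW M b k (map Gam I)).

Local Notation oc b k J := (ogw_computable b k (map incl J)).

Lemma ogw_computable_perm b k I I' : 0 <= omega D b -> perm_eq I I' ->
  ogw_computable b k I -> ogw_computable b k I'.
Proof.
by move=> b0 pI; apply: computable_ext => M /hPO hM; exact: ogw_perm.
Qed.

Lemma ogw_computable_divisor b k (i : 'I_(N D).+1) I : 0 <= omega D b ->
  degG i = 2%N -> ogw_computable b k I -> ogw_computable b k (i :: I).
Proof.
move=> b0 i2 /(computableZ (pairXL (classXL b) (Gam i))).
apply: computable_ext => M /hPO hM.
by rewrite (ogw_divisor_cons hgen n_odd k I hM b0 i2).
Qed.

Lemma ogw_computable_boundary b k : (k <= 1)%N -> 0 <= omega D b ->
  ogw_computable b k [::].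
Proof.
move=> k1 b0; have [dim|ndim] := pselect (open_deg b k 0 0).
  apply: (@computable_val _ _ P A Z (OpenValue b k [::])).
  by apply: hAB; exists b, k.
apply: computable0 => M /hPO hM; apply/eqP; apply: contrapT => /negP nz.
by apply: ndim; have := ogw_degree hM b0 nz; rewrite big_nil.
Qed.

Lemma ogw_computable_interior b i : 0 <= omega D b -> oc b 0 [:: i].
Proof.
move=> b0; have [dim|ndim] := pselect (open_deg b 0 1 (degG (incl i))).
  apply: (@computable_val _ _ P A Z (OpenValue b 0 [:: Gam (incl i)])).
  apply: hAI; exists b, (incl i); split=> //.
  by rewrite (kappa_eq hgen n_odd) (inclE hgen n_odd) -ltnS.
apply: computable0 => M /hPO hM; apply/eqP; apply: contrapT => /negP nz.
by apply: ndim; have := ogw_degree hM b0 nz; rewrite big_seq1.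
Qed.

Lemma ogw_computable0 k I : ogw_computable 0 k I.
Proof.
pose f := match I with
  | [:: i] => if (k == 1%N) && (Gam i == oneXL D) then -1 else 0
  | [:: i; j] => if k == 0%N then P_R (wedge (Gam i) (Gam j)) else 0
  | _ => 0 end.
apply: (@computable_ext _ _ _ _ _ (fun=> f)); last exact: computable_const.
by move=> M /hPO hM; rewrite ogw_zero.
Qed.

Lemma ogw_computable_degX (b : Pi D) k i J d :
  degD i = d.+2 ->
  (forall j l, degD j = 2%N -> degD l = d -> comp (fun M => \sum_k' coordD k' (Del j * Del l) *
     OGW M b k (map Gam (map incl (k' :: J))))) ->
  oc b k (i :: J).
Proof.
move=> id cjl.
have [Qlin Q0 Qi] := computable_coord_sum P A Z
  (fun k' M => OGW M b k (map Gam (map incl (k' :: J)))).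
apply: (Qi); apply: (degX_ind hgen Qlin Q0 (d := d)) => //.
by rewrite -id; exact: Delta_deg.
Qed.

Lemma leading_term_computable b k I e v (j l : 'I_(K D).+1) : 0 <= omega D b ->
  e + expo1 v = mexp k I ->
  comp (fun M => (expo_fact e)^-1 *
    \sum_k' coordD k' (Del j * Del l) * Omega_num M b (e + expo1 v + expo1 (tv k'))) ->
  comp (fun M => \sum_k' coordD k' (Del j * Del l) *
    OGW M b k (map Gam (incl k' :: I))).
Proof.
move=> b0 ev cS.
apply: (computable_unscale (c := (expo_fact e)^-1)).
  by rewrite invr_eq0 expo_fact_neq0.
apply: computable_ext cS => M /hPO hM; congr (_ * _); apply: eq_bigr => k' _.
by rewrite ev mexp_t Omega_num_list.
Qed.

(** * From energies below [E] to energies below [E + hbar] *)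

Section EnergyStep.
Variable E : R.
Hypothesis known : forall b e, omega D b < E -> comp (fun M => Omega_num M b e).

Section FixClass.
Variable b : Pi D.
Hypothesis bE : omega D b < E + hbar D.
Hypothesis b_ge0 : 0 <= omega D b.
Hypothesis b_neq0 : b != 0.

Lemma ogw_computable_deg0 k i J : degD i = 0%N -> oc b k (i :: J).
Proof.
move=> i0; apply: computable0 => M /hPO hM.
exact: (ogw_deg0 hgen n_odd hM k (map incl J) b_ge0 b_neq0 i0).
Qed.

Lemma known_left u v e p : p.1 + p.2 = (b, e) -> hbar D <= omega D p.2.1 ->
  comp (fun M => dOmega M u v p.1).
Proof.
case: p => -[b1 e1] [b2 e2] /= [b12 _] h2; apply/dOmega_computable/known.
by move: bE; rewrite -b12 raddfD /=; lra.
Qed.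

Lemma known_right u v e p : p.1 + p.2 = (b, e) -> hbar D <= omega D p.1.1 ->
  comp (fun M => dOmega M u v p.2).
Proof.
case: p => -[b1 e1] [b2 e2] /= [b12 _] h2; apply/dOmega_computable/known.
by move: bE; rewrite -b12 raddfD /=; lra.
Qed.

Lemma known_open_open u v u' v' e :
  no_constant_disk_all u v -> no_constant_disk_all u' v' ->
  comp (fun M => open_open M u v u' v' (b, e)).
Proof.
move=> nc nc'; apply: open_open_computable => // p pm h1 h2.
by split; [exact: known_left pm h2 | exact: known_right pm h1].
Qed.

Lemma known_closed_open_tail u i j e :
  comp (fun M => closed_open_tail M u (tv i) (tv j) (b, e)).
Proof.
apply: closed_open_tail_computable => l p pm h2.
exact: known_left pm h2.
Qed.

Lemma nc_tt i j : no_constant_disk_all (tv i) (tv j).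
Proof. by move=> M /hPO hM; exact: (no_constant_disk_tt hgen n_odd hM i j). Qed.

Lemma nc_ts i : degD i != 0%N -> no_constant_disk_all (tv i) None.
Proof. by move=> i0 M /hPO hM; exact: (no_constant_disk_ts hgen n_odd hM i0). Qed.

Lemma nc_ss : no_constant_disk_all None None.
Proof. by move=> M /hPO hM; exact: (no_constant_disk_ss hgen n_odd hM). Qed.

Lemma nc_st i : degD i != 0%N -> no_constant_disk_all None (tv i).
Proof. by move=> i0 M PM; apply/no_constant_disk_sym/(nc_ts i0). Qed.

(** One boundary point serves as the s-derivative in the second WDVV equation. There [Del j * Del l]
    gives the only leading term, and all others are known by their energy. *)
Lemma ogw_computable_insert_boundary k J : oc b k.+1 [::] -> oc b k.+1 J.
Proof.
move=> c0; elim: J => // i J IH.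
case id : (degD i) (degD_even hgen i) => [|[|[|d]]] // _.
- exact: ogw_computable_deg0.
- by apply: ogw_computable_divisor => //; rewrite degG_incl.
apply: (ogw_computable_degX id) => j l j2 ld.
have l0 : degD l != 0%N by rewrite ld.
have j0 : degD j != 0%N by rewrite j2.
pose e : expo D := mexp k (map incl J).
have ct := known_closed_open_tail None j l e.
have co1 := known_open_open e (nc_tt j l) nc_ss.
have co2 := known_open_open e (nc_ts j0) (nc_ts l0).
apply: (leading_term_computable (e := e) (v := None)) => //; first exact: mexp_s.
apply: computable_ext (computableB (computableB co1 co2) ct) => M PM.
have := WDVV_tts hgen n_odd (hPO PM) (tv j) (tv l) (b, e).
rewrite (closed_open_head hgen n_odd (hPC PM) (hPO PM) None).
set x1 := open_open _ _ _ _ _ _; set x2 := open_open _ _ _ _ _ _.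
set x3 := closed_open_tail _ _ _ _ _; set x4 := _ * _.
lra.
Qed.

(** WDVV trades the product of [j] and [l] next to [c] for the product of [l] and [c] next to the
    divisor [j], which the divisor axiom removes. A single insertion is an initial value. *)
Lemma ogw_computable_insert_interior J : oc b 0 J.
Proof.
have [m] := ubnP (size J); elim: m J => // m IH J; rewrite ltnS.
have div j J' : degD j = 2%N -> (size J' < m)%N -> oc b 0 (j :: J').
  by move=> j2 sJ'; apply: ogw_computable_divisor; rewrite ?degG_incl //; exact: IH.
case: J => [|i [|c J]] sm; first exact: ogw_computable_boundary.
  exact: ogw_computable_interior.
have swap j l J' : oc b 0 (j :: l :: J') -> oc b 0 (l :: j :: J').
  by apply: ogw_computable_perm => //; apply/seq.permP => q /=; rewrite addnCA.
have [c0|c0] := eqVneq (degD c) 0%N; first exact/swap/ogw_computable_deg0.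
case id : (degD i) (degD_even hgen i) => [|[|[|d]]] // _.
- exact: ogw_computable_deg0.
- exact: div.
apply: (ogw_computable_degX id) => j l j2 ld.
have l0 : degD l != 0%N by rewrite ld.
have j0 : degD j != 0%N by rewrite j2.
pose e : expo D := mexp 0 (map incl J).
have ct1 := known_closed_open_tail (tv c) j l e.
have ct2 := known_closed_open_tail (tv j) l c e.
have co1 := known_open_open e (nc_ts j0) (nc_tt l c).
have co2 := known_open_open e (nc_tt j l) (nc_st c0).
have ch : comp (fun M => (expo_fact e)^-1 * \sum_k coordD k (Del l * Del c) *
    Omega_num M b (e + expo1 (tv j) + expo1 (tv k))).
  apply/computableZ/computable_sum => k _; apply: computableZ.
  apply: computable_ext (swap _ _ _ (div j (k :: J) j2 sm)) => M PM.
  by rewrite !mexp_t (Omega_num_list hgen n_odd (hPO PM)).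
apply: (leading_term_computable (e := e) (v := tv c)) => //; first exact: mexp_t.
apply: computable_ext (computableD (computableB (computableB
  (computableD ch ct2) co1) ct1) co2) => M PM.
have := WDVV_ttt hgen n_odd (hPO PM) (tv j) (tv l) (tv c) (b, e).
rewrite (closed_open_head hgen n_odd (hPC PM) (hPO PM) (tv j)).
rewrite (closed_open_head hgen n_odd (hPC PM) (hPO PM) (tv c)).
set x1 := open_open _ _ _ _ _ _; set x2 := open_open _ _ _ _ _ _.
set x3 := closed_open_tail _ _ _ _ _; set x4 := closed_open_tail _ _ _ _ _.
set x5 := _ * _; set x6 := _ * _.
lra.
Qed.

End FixClass.

End EnergyStep.
End OpenReconstruction.

(** * Disks with at least two boundary points and no interior insertion *)

Section BoundaryReconstruction.
Local Open Scope classical_set_scope.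
Variables (R : realType) (D : topData R).
Hypothesis hgen : agenv (degX D 2) = fullv.
Hypothesis n_odd : odd (dimL D).
Variables (P : invariants D -> Prop) (A Z : set (value D)).
Hypothesis hPC : forall M, P M -> closed_axioms M.
Hypothesis hPO : forall M, P M -> frobenius_superpotential M.
Hypothesis hAC : forall v, @initial_closed R D v -> A v.
Implicit Types (b g : Pi D) (e : expo D) (M : invariants D) (u v w : var D).
Implicit Types (i j l : 'I_(K D).+1) (J : seq 'I_(K D).+1).

Local Notation comp := (computable P A Z).

Variables (b' : Pi D) (p j : 'I_(K D).+1).
Hypothesis n_gt1 : (1 < dimL D)%N.
Hypothesis hSL : forall x : H2XL D, S_L x <-> ker_omega_mu x.
Hypothesis b'_hbar : omega D b' = hbar D.
Hypothesis p_top : degD p = (dimL D).*2.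
Hypothesis j2 : degD j = 2%N.
Hypothesis pair_j : pairXL (classXL b') (Gam (incl j)) != 0 :> R.
Hypothesis hZ : Z (OpenValue b' 0 [:: Gam (incl p)]).
Hypothesis hnz : forall M, P M -> OGW M b' 0 [:: Gam (incl p)] != 0.

Variables (E : R) (k : nat).
Hypothesis lower : forall h g J, (h < k.+2)%N -> omega D g < E ->
  comp (fun M => Omega_num M g (mexp h (map incl J))).

(** The shift by [b'] places the leading term of this Novikov series at class 0, as the geometric
    series requires. *)
Let disk g M : R := Omega_num M (b' + g) (mexp 0 (map incl [:: p; j])).
Let bdry g M : R := Omega_num M g (mexp k.+2 [::]).
Let conv g M : R := \sum_(y \in [set: Pi D]) disk y M * bdry (g - y) M.

Let e : expo D := mexp k [::].

Lemma mexp_split e1 e2 : e1 + e2 = e ->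
  exists k1 k2, [/\ e1 = mexp k1 [::], e2 = mexp k2 [::] & (k1 + k2)%N = k].
Proof.
have [k1 [I1 ->]] := mexp_surj e1; have [k2 [I2 ->]] := mexp_surj e2.
rewrite mexpD => /mexp_inj[kE /perm_nilP/eqP].
rewrite -size_eq0 size_cat addn_eq0 !size_eq0 => /andP[/eqP -> /eqP ->].
by exists k1, k2.
Qed.

Lemma energy_shift g p1 p2 : p1 + p2 = (g + b', e) ->
  omega D p1.1 + omega D p2.1 = omega D g + hbar D.
Proof. by case: p1 p2 => [b1 e1] [b2 e2] [b12 _]; rewrite -raddfD b12 raddfD b'_hbar. Qed.

Lemma dOmega_st_computable i q : omega D q.1 < E ->
  (exists k1, (k1 <= k)%N /\ q.2 = mexp k1 [::]) ->
  comp (fun M => dOmega M None (tv i) q) /\ comp (fun M => dOmega M (tv i) None q).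
Proof.
case: q => b e1 /= bE [k1 [k1k ->]].
by split; apply: dOmega_computable; rewrite ?mexp_s mexp_t ?mexp_s;
  apply: (lower (h := k1.+1) [:: i]).
Qed.

(** The cup product of [j] and the top class [p] vanishes for degree reasons, and with it the
    leading term. Every other open factor carries exactly one of the s-derivatives, hence at most k
    + 1 boundary points, and leaves energy at least [hbar] to its partner. *)
Lemma open_open_jpss_computable g : omega D g < E ->
  comp (fun M => open_open M (tv j) (tv p) None None (g + b', e)).
Proof.
move=> gE.
have j0 : degD j != 0%N by rewrite j2.
have p0 : degD p != 0%N by rewrite p_top; lia.
have st i q q' : q + q' = (g + b', e) -> hbar D <= omega D q'.1 ->
    comp (fun M => dOmega M None (tv i) q) /\ comp (fun M => dOmega M (tv i) None q).
  move=> qq h; apply: dOmega_st_computable.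
    by have := energy_shift qq; lra.
  move: qq; case: q => b1 e1; case: q' {h} => b2 e2 [_ /mexp_split[k1 [k2 [-> _ kE]]]].
  by exists k1; rewrite -kE leq_addr.
have ct : comp (fun M => closed_open_tail M None (tv j) (tv p) (g + b', e)).
  apply: (closed_open_tail_computable hgen n_odd hPC hPO hAC) => i q qm h2.
  by have [] := st i _ _ qm h2.
have nc i : degD i != 0%N -> no_constant_disk_all P (tv i) None.
  by move=> i0 M /hPO hM; exact: (no_constant_disk_ts hgen n_odd hM i0).
have co : comp (fun M => open_open M (tv j) None (tv p) None (g + b', e)).
  apply: (open_open_computable hgen n_odd hPO (nc j j0) (nc p p0)) => q qm h1 h2.
  have [_ c1] := st j _ _ qm h2; split=> //.
  rewrite addrC in qm; by have [] := st p _ _ qm h1.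
apply: computable_ext (computableD ct co) => M PM.
have := WDVV_tts hgen n_odd (hPO PM) (tv j) (tv p) (g + b', e).
rewrite (closed_open_head hgen n_odd (hPC PM) (hPO PM) None).
have -> : Del j * Del p = 0.
  apply/eqP; rewrite -memv0; have [_ _ gt0] := degX_grading D.
  rewrite -(gt0 (degD j + degD p)%N); first by rewrite degX_mul ?Delta_deg.
  by rewrite j2 p_top; lia.
rewrite big1 => [|i _]; last by rewrite linear0 mul0r.
set x1 := open_open _ _ _ _ _ _; set x2 := open_open _ _ _ _ _ _.
set x3 := closed_open_tail _ _ _ _ _.
lra.
Qed.

Let splittings g : set ((Pi D * expo D) * (Pi D * expo D)) :=
  [set q | q.1 + q.2 = (g + b', e)].

(** The terms with all of s^k in the second factor form the convolution. In the others the first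
    factor has at most k boundary points and the second fewer than k + 2, so both are known. *)
Lemma conv_computable g : omega D g < E -> comp (conv g).
Proof.
move=> gE.
pose B := [set q : (Pi D * expo D) * (Pi D * expo D) | q.1.2 = 0].
have ncT : no_constant_disk_all P (tv j) (tv p).
  by move=> M /hPO hM; exact: (no_constant_disk_tt hgen n_odd hM j p).
have ncS : no_constant_disk_all P None None.
  by move=> M /hPO hM; exact: (no_constant_disk_ss hgen n_odd hM).
have c2 : comp (fun M => \sum_(q \in splittings g `&` ~` B)
    dOmega M (tv j) (tv p) q.1 * dOmega M None None q.2).
  apply: (open_open_part_computable hgen n_odd hPO (m := (g + b', e)) _ ncT ncS).
    by move=> q [].
  move=> [[b1 e1] [b2 e2]] [/= qm nB] h1 h2; have eg := energy_shift qm.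
  have : (b1, e1) + (b2, e2) = (g + b', e) by [].
  move=> [_ /mexp_split[k1 [k2 [e1E e2E kE]]]].
  have k1_gt0 : (0 < k1)%N.
    by rewrite lt0n; apply: contra_notN nB => /eqP k10; rewrite /B /= e1E k10 mexp0.
  split; apply: dOmega_computable.
    rewrite e1E !mexp_t; apply: (lower (h := k1) [:: p; j]); first by lia.
    by move: eg => /=; lra.
  rewrite e2E !mexp_s; apply: (lower (h := k2.+2) [::]); first by lia.
  by move: eg => /=; lra.
apply: computable_ext (computableZ (expo_fact e)
  (computableB (open_open_jpss_computable gE) c2)) => M PM.
rewrite /open_open /smul (fsbigIDS B).
  2: exact: (@open_open_finite _ _ P hPO M _ _ _ _ (g + b', e) _ PM).
rewrite addrK (reindex_fsbig
  (fun y : Pi D => ((b' + y, 0), (g - y, e)) : (Pi D * expo D) * (Pi D * expo D)) [set: Pi D]).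
  rewrite mulr_fsumr; apply: eq_fsbigr => y _.
  rewrite !dOmegaE expo_fact0 invr1 mul1r -mexp0 !mexp_t !mexp_s mulrCA.
  by rewrite mulVKf ?expo_fact_neq0.
split.
- move=> y _; split=> //=; congr pair; last by rewrite add0r.
  by rewrite -addrA [y + _]addrC subrK addrC.
- by move=> y z _ _ [/addrI].
move=> [[b1 e1] [b2 e2]] [[/= b12 e12]]; rewrite /B /= => e10.
exists (b1 - b') => //; rewrite addrC subrK -e12 e10 add0r; congr (_, (_, _)).
by rewrite opprB addrA -b12 [b1 + b2]addrC addrK.
Qed.

Lemma disk0 M : P M ->
  disk 0 M = pairXL (classXL b') (Gam (incl j)) * val_of M (OpenValue b' 0 [:: Gam (incl p)]).
Proof.
move=> PM; have b'0 : 0 <= omega D b' by rewrite b'_hbar ltW ?hbar_gt0.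
rewrite /disk addr0 (Omega_num_list hgen n_odd (hPO PM)) //=.
rewrite -(ogw_divisor_cons hgen n_odd 0 [:: incl p] (hPO PM)) ?degG_incl //.
apply: (@ogw_perm _ _ hgen n_odd _ (hPO PM) _ _ [:: incl p; incl j]) => //.
by apply/seq.permP => q /=; rewrite addnCA.
Qed.

(** If [g] has energy 0, the degree axiom at [b' + g] and at [b'] gives [g] Maslov index 0, so [g]
    comes from S_L and is 0. Thus the leading coefficient is a single value, by which one can
    divide. *)
Lemma disk_support M g : P M -> disk g M != 0 -> g = 0 \/ 0 < omega D g.
Proof.
move=> PM nz; have hM := hPO PM.
have ge0 : 0 <= omega D g.
  case/orP: (Omega_num_energy hgen n_odd hM nz) => [/eqP b0|].
    have := no_constant_disk_tt hgen n_odd hM j p (mexp 0 [::]).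
    by rewrite !mexp_t => z; move: nz; rewrite /disk b0 z eqxx.
  by rewrite raddfD /= b'_hbar; lra.
have [g0|g0] := eqVneq (omega D g) 0; last by right; rewrite lt_def g0.
left; rewrite -[g]classXLE; apply/hSL; split; rewrite classXLE //.
have bg : 0 <= omega D (b' + g) by rewrite raddfD /= b'_hbar g0 addr0 ltW ?hbar_gt0.
have b'0 : 0 <= omega D b' by rewrite b'_hbar ltW ?hbar_gt0.
move: nz; rewrite /disk (Omega_num_list hgen n_odd hM) // => /(ogw_degree hM bg).
have := ogw_degree hM b'0 (I := [:: incl p]) (hnz PM).
rewrite /open_deg !big_cons !big_nil /= !degG_incl // j2 [mu D (_ + _)]raddfD.
by lia.
Qed.

Lemma boundary_computable g : omega D g < E -> comp (bdry g).
Proof.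
apply: (geometric_computable (a := disk) (c := conv) (h := hbar D)
  (r := pairXL (classXL b') (Gam (incl j)))
  (v0 := OpenValue b' 0 [:: Gam (incl p)])) => //.
- move=> M y /hPO hM nz.
  case/orP: (Omega_num_energy hgen n_odd hM nz) => [/eqP b0|//].
  have := no_constant_disk_ss hgen n_odd hM (mexp k [::]).
  by rewrite !mexp_s => z; move: nz; rewrite /bdry b0 z eqxx.
- exact: disk_support.
- move=> M F /hPO hM.
  have fin := Omega_num_finite hM (mexp 0 (map incl [:: p; j])) (hbar D + F).
  have fin' := finite_image (fun y => y - b') fin.
  apply: sub_finite_set fin' => y [nz yF]; exists (b' + y); last by rewrite addrC addKr.
  by split=> //; rewrite raddfD /= b'_hbar lerD2l.
- move=> y yE; apply: (lower (h := 0) [:: p; j]) => //.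
  by rewrite raddfD /= b'_hbar addrC.
- exact: conv_computable.
- exact: disk0.
Qed.

End BoundaryReconstruction.

(** * Induction on the energy, all boundary points and insertions included *)

Section LevelInduction.
Local Open Scope classical_set_scope.
Variables (R : realType) (D : topData R).
Hypothesis hgen : agenv (degX D 2) = fullv.
Hypothesis n_odd : odd (dimL D).
Variables (P : invariants D -> Prop) (A Z : set (value D)).
Hypothesis hPC : forall M, P M -> closed_axioms M.
Hypothesis hPO : forall M, P M -> frobenius_superpotential M.
Hypothesis hAC : forall v, @initial_closed R D v -> A v.
Hypothesis hAB : forall v, @initial_boundary R D v -> A v.
Hypothesis hAI : forall v, @initial_interior R D v -> A v.
Implicit Types (b g : Pi D) (e : expo D) (M : invariants D).
Implicit Types (i j l : 'I_(K D).+1) (J : seq 'I_(K D).+1).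

Local Notation comp := (computable P A Z).

Variables (b' : Pi D) (p j : 'I_(K D).+1).
Hypothesis n_gt1 : (1 < dimL D)%N.
Hypothesis hSL : forall x : H2XL D, S_L x <-> ker_omega_mu x.
Hypothesis b'_hbar : omega D b' = hbar D.
Hypothesis p_top : degD p = (dimL D).*2.
Hypothesis j2 : degD j = 2%N.
Hypothesis pair_j : pairXL (classXL b') (Gam (incl j)) != 0 :> R.
Hypothesis hZ : Z (OpenValue b' 0 [:: Gam (incl p)]).
Hypothesis hnz : forall M, P M -> OGW M b' 0 [:: Gam (incl p)] != 0.

Lemma Omega_num_computable b k I :
  (0 <= omega D b -> ogw_computable P A Z b k I) ->
  comp (fun M => Omega_num M b (mexp k I)).
Proof.
move=> c; have [b0|b0] := leP 0 (omega D b); last first.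
  by apply: computable0 => M _; exact: Omega_num_neg.
apply: computable_ext (c b0) => M /hPO hM.
by rewrite (Omega_num_list hgen n_odd hM).
Qed.

(** The induction on k treats all classes of the energy range at once, because the division of
    Novikov series mixes classes. *)
Lemma level_step (E : R) :
  (forall b e, omega D b < E -> comp (fun M => Omega_num M b e)) ->
  forall k b J, omega D b < E + hbar D ->
    comp (fun M => Omega_num M b (mexp k (map incl J))).
Proof.
move=> known; elim/ltn_ind => k IH b J bE.
have [->|b0] := eqVneq b 0.
  by apply: Omega_num_computable => _; exact: ogw_computable0.
apply: Omega_num_computable => bge.
case: k IH => [|k] IH.
  exact: (ogw_computable_insert_interior hgen n_odd hPC hPO hAC hAB hAI known).
apply: (ogw_computable_insert_boundary hgen n_odd hPC hPO hAC known) => //.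
case: k IH => [|k] IH; first exact: (ogw_computable_boundary Z hPO hAB).
have := boundary_computable hgen n_odd hPC hPO hAC n_gt1 hSL b'_hbar p_top j2
  pair_j hZ hnz (E := E + hbar D) (k := k) (fun h g J' hk gE => IH h hk g J' gE) bE.
by apply: computable_ext => M /hPO hM; rewrite (Omega_num_list hgen n_odd hM).
Qed.

(** Each Gamma_diamond raises k by one, so all k are assumed; [J] collects the other insertions met
    on the way. *)
Lemma wall_crossing_computable b : 0 <= omega D b ->
  (forall k J, ogw_computable P A Z b k (map incl J)) ->
  forall k I, ogw_computable P A Z b k I.
Proof.
move=> b0 c k I; rewrite -[I]cats0 -[[::]]/(map incl [::]).
elim: I k [::] => [|i I IH] k J /=; first exact: c.
have [[l ->]|->] := incl_or_max hgen n_odd i.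
  apply: (ogw_computable_perm hgen n_odd hPO b0 _ (IH k (l :: J))).
  by rewrite /= -cat1s perm_catCA.
apply: computable_ext (computableN (IH k.+1 J)) => M /hPO hM.
by rewrite [RHS](ogw_wall hM) ?L_nullT.
Qed.

Lemma level_computable n b e : omega D b < n%:R * hbar D ->
  comp (fun M => Omega_num M b e).
Proof.
elim: n b e => [|n IH] b e bn.
  apply: computable0 => M _; apply: Omega_num_neg.
  by rewrite mul0r in bn.
have [k [I ->]] := mexp_surj e; apply: Omega_num_computable => b0.
apply: (wall_crossing_computable b0) => k' J.
have bE : omega D b < n%:R * hbar D + hbar D.
  by rewrite -[X in _ + X]mul1r -mulrDl natr1.
apply: computable_ext (level_step IH k' J bE) => M /hPO hM.
by rewrite (Omega_num_list hgen n_odd hM).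
Qed.

Lemma ogw_all_computable b k s : 0 <= omega D b ->
  comp (fun M => OGW M b k s).
Proof.
(* The prefix [I] of basis elements allows [s] to be expanded one class at a time. *)
move=> b0; suff : forall I, comp (fun M => OGW M b k (map Gam I ++ s)) by move/(_ [::]).
elim: s => [|x s IH] I.
  have bn : omega D b < (Num.bound (omega D b / hbar D))%:R * hbar D.
    by rewrite -ltr_pdivrMr ?hbar_gt0 // archi_boundP // divr_ge0 // ltW ?hbar_gt0.
  apply: computable_ext (level_computable (mexp k I) bn) => M /hPO hM.
  by rewrite (Omega_num_list hgen n_odd hM) // cats0.
apply: (computable_ext (f := fun M => \sum_i coord (Gamma D) i x *
  OGW M b k (map Gam (rcons I i) ++ s))) => [M /hPO hM|].
  rewrite {2}(basis_tnth (Gamma_basis D) x) (multilinear_sum (ogw_linear hM k b0)).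
  by apply: eq_bigr => i _; rewrite map_rcons cat_rcons.
by apply: computable_sum => i _; apply: computableZ; exact: IH.
Qed.

End LevelInduction.

(** The symplectic class integrates over [b] to its energy, so some basis element of degree 2 has
    nonzero integral. It is not Gamma_diamond, whose degree n + 1 exceeds 2. *)
Lemma symp_divisor (R : realType) (D : topData R) (b : Pi D) :
  agenv (degX D 2) = fullv -> odd (dimL D) -> (1 < dimL D)%N ->
  omega D b != 0 -> exists2 j : 'I_(K D).+1, degD j = 2%N &
    pairXL (classXL b) (Gam (incl j)) != 0 :> R.
Proof.
move=> hgen n_odd n_gt1 b0.
have : pairXL (classXL b) (symp D) != 0 :> R by rewrite symp_pair classXLE.
rewrite (basis_tnth (Gamma_basis D) (symp D)) linear_sum => /sum_neq0[i].
rewrite linearZ mulf_eq0 negb_or => /andP[ci pi].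
have i2 := coord_deg (degXL_grading D) (Gamma_basis D) (@Gamma_deg _ D) (symp_deg D) ci.
have [[j ij]|im] := incl_or_max hgen n_odd i.
  by exists j; rewrite -?ij // -(degG_incl hgen n_odd) -ij.
by move: i2; rewrite im (degG_max hgen n_odd); lia.
Qed.

Theorem theorem2 (R : realType) (D : topData R) (M : invariants D)
    (hGW : closed_axioms M) (hOmega : frobenius_superpotential M)
    (hgen : agenv (degX D 2) = fullv)
    (hSL : forall x : H2XL D, S_L x <-> ker_omega_mu x)
    (b' : Pi D) (hb'_pos : 0 < omega D b') (hb' : omega D b' = hbar D)
    (i1 : 'I_(N D).+1) (I : seq 'I_(N D).+1)
    (hI : all (fun i : 'I_(N D).+1 => (i <= kappa D)%N) (i1 :: I))
    (hnz : nonzero_at M b' (i1 :: I))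
    (hmin : minimal_length M (size (i1 :: I)))
    (hor : (1 < size (i1 :: I))%N \/ degG i1 = (dimL D).*2) :
  forall (b : Pi D) (k : nat) (s : seq (HXL D)), 0 <= omega D b ->
    computable_from
      (fun M' : invariants D =>
         [/\ closed_axioms M', frobenius_superpotential M',
             nonzero_at M' b' (i1 :: I) & minimal_length M' (size (i1 :: I))])
      (initial_values b' (i1 :: I)) (initial_disk b' (i1 :: I))
      (OpenValue b k s).
Proof.
have b'0 : 0 <= omega D b' := ltW hb'_pos.
have n_odd : odd (dimL D) := dimL_odd hgen hOmega b'0 hI hnz.
have [J JE] : exists J, i1 :: I = map incl J.
  elim: (i1 :: I) hI => [|i s IH] /=; first by exists [::].
  move=> /andP[/(incl_kappa hgen n_odd)[l ->] /IH[J ->]].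
  by exists (l :: J).
(* Minimality forces l' = 1, and [hor] then says that the insertion has top degree. *)
have J1 : (size J <= 1)%N.
  rewrite leqNgt; apply/negP => J1; move: hnz hmin.
  rewrite /nonzero_at JE size_map => nz mJ.
  by rewrite (ogw_minimal_long hgen n_odd hGW hOmega hb' J1 mJ) eqxx in nz.
case: J JE J1 => [|p []] //= -[i1E IE] _; subst i1 I.
have {hor} p_top : degD p = (dimL D).*2.
  by case: hor => //; rewrite degG_incl.
(* For n = 1 the insertion of degree 2n is a divisor, and the divisor axiom with minimality for the
   empty list makes the nonzero value 0. *)
have n_gt1 : (1 < dimL D)%N.
  rewrite ltn_neqAle dimL_gt0 andbT; apply/eqP => n1.
  move: hnz; rewrite /nonzero_at (ogw_divisor_cons hgen n_odd 0 [::] hOmega b'0).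
    by rewrite (hmin b' [::]) // mulr0 eqxx.
  by rewrite (degG_incl hgen n_odd) p_top -n1.
have [|j j2 pj] := symp_divisor hgen n_odd n_gt1 (b := b').
  by rewrite gt_eqF.
move=> b k s b0.
apply: (@ogw_all_computable _ _ hgen n_odd _ _ _ _ _ _ _ _ b' p j) => //.
- by move=> M' [].
- by move=> M' [].
- by move=> v hv; right.
- by move=> v hv; left; left; right.
- by move=> v hv; left; right.
- by move=> M' [].
Qed.
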